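(* For each positive integer $n$, the Brauer semigroups $\mathfrak{B}_{2n}$ and $\mathfrak{B}_{2n+1}$ satisfy $c(\mathfrak{B}_{2n})=c(\mathfrak{B}_{2n+1})=n$, where $c$ denotes Krohn--Rhodes complexity.
   Context: All semigroups are finite. Krohn--Rhodes complexity: a semigroup $S$ divides $T$ if $S$ is a homomorphic image of a subsemigroup of $T$. The (group or Krohn--Rhodes) complexity $c(S)$ is the least integer $m\ge 0$ such that $S$ divides an iterated wreath product $A_m\wr G_m\wr A_{m-1}\wr\cdots\wr A_1\wr G_1\wr A_0$, where the $G_i$ are finite groups and the $A_i$ are finite aperiodic semigroups (all of whose subgroups are trivial). (Here one may take $S\wr T=S^{T^I}\rtimes T$, where $T^I$ is $T$ with a new identity adjoined, with $(f,t)(g,u)=(h,tu)$, $h(x)=f(x)g(xt)$, and bracket iterated products to the right.) Brauer semigroup: for a positive integer $n$ let $[n]=\{1,\dots,n\}$, $[n]'=\{1',\dots,n'\}$, $[n]''=\{1'',\dots,n''\}$ be disjoint copies. The partition semigroup $\mathfrak{C}_n$ consists of all partitions (equivalently, equivalence relations) of $[n]\cup[n]'$. The product $\xi\eta$ is computed as follows: let $\eta'$ be the equivalence relation on $[n]'\cup[n]''$ obtained from $\eta$ by replacing each $k$ by $k'$ and each $k'$ by $k''$; take the equivalence relation on $[n]\cup[n]'\cup[n]''$ generated by $\xi\cup\eta'$; restrict it to $[n]\cup[n]''$; finally replace each $k''$ by $k'$. This makes $\mathfrak{C}_n$ a monoid. $\mathfrak{B}_n$ is the subsemigroup of $\mathfrak{C}_n$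 consisting of all elements all of whose blocks have size exactly $2$. *)

(* Defs.v *)
From HB Require Import structures.
From mathcomp Require Import all_boot.

Set Implicit Arguments.
Unset Strict Implicit.
Unset Printing Implicit Defensive.

Local Open Scope group_scope.

(* HB only accepts this structure while fingroup, whose structures it would   *)
(* sit below, is not yet loaded.                                              *)
#[short(type="finSemigroupType")]
HB.structure Definition FinSemigroup := {S of Semigroup S & Finite S}.

From mathcomp Require Import fingroup zify.

Definition semigroup_of_group (G : finGroupType) : finSemigroupType :=
  HB.pack_for finSemigroupType (FinGroup.sort G)
    (Semigroup.class G) (Finite.class G).

(* S divides T *)
Definition divides (S T : finSemigroupType) : Prop :=
  exists (A : {set T}) (f : T -> S),
    [/\ mulg_closed A, {in A &, {morph f : x y / x * y}}
      & f @: A = [set: S]].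

Definition is_subgroup (S : finSemigroupType) (A : {set S}) : Prop :=
  mulg_closed A /\
  exists2 e, e \in A & forall x, x \in A ->
    [/\ e * x = x, x * e = x
      & exists2 y, y \in A & x * y = e /\ y * x = e].

Definition aperiodic (S : finSemigroupType) : Prop :=
  forall A : {set S}, is_subgroup A -> #|A| = 1%N.

Section Wreath.
Variables S T : finSemigroupType.

(* T^I is option T, with None the adjoined identity I. *)
Record wreath := Wreath { wreath_val : {ffun option T -> S} * T }.

HB.instance Definition _ := [isNew for wreath_val].
HB.instance Definition _ := [Finite of wreath by <:].

Definition act1 (x : option T) (t : T) : option T :=
  Some (if x is Some s then s * t else t).

Definition wreath_mul (a b : wreath) : wreath :=
  let: (f, t) := wreath_val a in
  let: (g, u) := wreath_val b in
  Wreath ([ffun x => f x * g (act1 x t)], t * u).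

Lemma wreath_mulA : associative wreath_mul.
Proof.
case=> [[f t]] [[g u]] [[h v]]; rewrite /wreath_mul /=; congr (Wreath (_, _));
  last exact: mulgA.
apply/ffunP=> x; rewrite !ffunE mulgA; congr (_ * h _).
by case: x => [s|]; rewrite /act1 ?mulgA.
Qed.

HB.instance Definition _ := isSemigroup.Build wreath wreath_mulA.

End Wreath.

(* kr_product m X : X is some A_m wr (G_m wr ( ... (A_1 wr (G_1 wr A_0)))). *)
Inductive kr_product : nat -> finSemigroupType -> Prop :=
| KRBase (A : finSemigroupType) : aperiodic A -> kr_product 0 A
| KRStep m (A : finSemigroupType) (G : finGroupType) (X : finSemigroupType) :
    aperiodic A -> kr_product m X ->
    kr_product m.+1 (wreath A (wreath (semigroup_of_group G) X)).

Definition kr_le (S : finSemigroupType) (m : nat) : Prop :=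
  exists2 X, kr_product m X & divides S X.

(* c(S) = m *)
Definition complexity_is (S : finSemigroupType) (m : nat) : Prop :=
  kr_le S m /\ forall k, kr_le S k -> (m <= k)%N.

Definition rel_img (X Y : finType) (f : X -> Y) (R : rel X) : rel Y :=
  fun z w => [exists x, exists y, [&& R x y, z == f x & w == f y]].

Lemma rel_imgP (X Y : finType) (f : X -> Y) (R : rel X) z w :
  reflect (exists x y, [/\ R x y, z = f x & w = f y]) (rel_img f R z w).
Proof.
apply: (iffP existsP) => [[x /existsP[y /and3P[Rxy /eqP-> /eqP->]]]|].
  by exists x, y.
by case=> x [y [Rxy -> ->]]; exists x; apply/existsP; exists y; rewrite Rxy !eqxx.
Qed.

Lemma rel_img_sym (X Y : finType) (f : X -> Y) (R : rel X) :
  symmetric R -> symmetric (rel_img f R).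
Proof.
by move=> symR z w; apply/rel_imgP/rel_imgP => -[x [y [Rxy -> ->]]];
  exists y, x; rewrite symR.
Qed.

Lemma eq_rel_img (X Y : finType) (f g : X -> Y) (R : rel X) :
  f =1 g -> rel_img f R =2 rel_img g R.
Proof.
by move=> fg z w; apply/rel_imgP/rel_imgP => -[x [y [Rxy -> ->]]];
  exists x, y; rewrite !fg.
Qed.

Lemma rel_img_comp (X Y Z : finType) (f : X -> Y) (g : Y -> Z) (R : rel X) :
  rel_img g (rel_img f R) =2 rel_img (g \o f) R.
Proof.
move=> z w; apply/rel_imgP/rel_imgP.
  by case=> _ [_ [/rel_imgP[x [y [Rxy -> ->]]] -> ->]]; exists x, y.
case=> x [y [Rxy -> ->]]; exists (f x), (f y); split=> //.
by apply/rel_imgP; exists x, y.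
Qed.

Lemma rel_imgU (X Y : finType) (f : X -> Y) (R R' : rel X) :
  rel_img f (relU R R') =2 relU (rel_img f R) (rel_img f R').
Proof.
move=> z w; apply/rel_imgP/orP.
  by case=> x [y [/orP[] Rxy -> ->]]; [left|right]; apply/rel_imgP; exists x, y.
by case=> /rel_imgP[x [y [Rxy -> ->]]]; exists x, y; rewrite /= Rxy ?orbT.
Qed.

Section Contract.

(* Contracting, in a graph on Z, the part lying over X: connectedness between *)
(* vertices of Y is unchanged when that part is replaced by its trace on the  *)
(* overlap K of X and Y.                                                      *)
Variables (X Y Z K : finType) (i : Y -> Z) (j : X -> Z) (k : K -> X) (l : K -> Y).
Variables (e : rel X) (d : rel Y).
Hypotheses (i_inj : injective i) (j_inj : injective j).
Hypothesis ilk : forall c, i (l c) = j (k c).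
Hypothesis pullback : forall y x, i y = j x -> exists2 c, y = l c & x = k c.

Let E := relU (rel_img j e) (rel_img i d).
Let F := relU (rel_img l [rel c c' | connect e (k c) (k c')]) d.

Lemma connect_contract y y' : connect E (i y) (i y') = connect F y y'.
Proof.
apply/idP/idP; last first.
  have jE x x' : connect e x x' -> connect E (j x) (j x').
    case/connectP=> p; elim: p x => [|x1 p IHp] x /=; first by move=> _ ->.
    case/andP=> exx1 pth lst; apply: connect_trans (IHp _ pth lst).
    by apply: connect1; apply/orP; left; apply/rel_imgP; exists x, x1.
  case/connectP=> p; elim: p y => [|y1 p IHp] y /=; first by move=> _ ->.
  case/andP=> Fyy1 pth lst; apply: connect_trans (IHp _ pth lst).
  case/orP: Fyy1 => [/rel_imgP[c [c' [cc' -> ->]]]|dyy1].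
    by rewrite !ilk; apply: jE.
  by apply: connect1; apply/orP; right; apply/rel_imgP; exists y, y1.
pose near v := exists2 z, connect F y z & (i z = v \/
   exists c x, [/\ z = l c, v = j x & connect e (k c) x]).
have FK c c' : connect e (k c) (k c') -> connect F (l c) (l c').
  by move=> h; apply: connect1; apply/orP; left; apply/rel_imgP; exists c, c'.
have near_i z : near (i z) -> connect F y z.
  case=> z' yz' [/i_inj <- //|[c [x [z'E /pullback[c' zE xE] ecx]]]].
  by apply: connect_trans yz' _; rewrite z'E zE; apply: FK; rewrite -xE.
have nearE v w : near v -> E v w -> near w.
  move=> nv /orP[] /rel_imgP.
    case=> x [x' [exx' vE wE]].
    case: nv => z yz [zv|[c [x0 [zE vE' cx0]]]].
      move: zv; rewrite vE => /pullback[c zE xE].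
      by exists z => //; right; exists c, x'; split=> //; apply: connect1; rewrite -xE.
    exists z => //; right; exists c, x'; split=> //.
    move: vE'; rewrite vE => /j_inj xE; rewrite -xE in cx0.
    exact: connect_trans cx0 (connect1 _).
  case=> z [z' [dzz' vE wE]]; exists z'; last by left.
  apply: connect_trans (near_i z _) (connect1 _); first by rewrite -vE.
  by apply/orP; right.
have near0 : near (i y) by exists y; [exact: connect0 | left].
case/connectP=> p; elim: p (i y) near0 => [|v p IHp] u nu /=.
  by move=> _ uE; apply: near_i; rewrite uE.
by case/andP=> Euv pth lst; apply: (IHp v) => //; apply: nearE Euv.
Qed.

End Contract.

Section PartitionSemigroup.
Variable n : nat.

(* k is inl k and k' is inr k; in the three-row set [n] + [n]' + [n]'' the    *)
(* points k, k', k'' are inl (inl k), inl (inr k) and inr k.                  *)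
Definition point : finType := ('I_n + 'I_n)%type.
Definition point3 : finType := (point + 'I_n)%type.

Record partition_semigroup := PartitionSemigroup {
  blocks : {set {set point}};
  blocksP : partition blocks [set: point]
}.

HB.instance Definition _ := [isSub for blocks].
HB.instance Definition _ := [Finite of partition_semigroup by <:].

Implicit Types xi eta zeta : partition_semigroup.

Definition same_block xi : rel point := fun x y => y \in pblock (blocks xi) x.

Definition upper (x : point) : point3 := inl x.
Definition lower (x : point) : point3 :=
  match x with inl k => inl (inr k) | inr k => inr k end.
Definition outer (x : point) : point3 :=
  match x with inl k => inl (inl k) | inr k => inr k end.

(* The union of xi and eta'. It is symmetric, so connect (glue xi eta) is the *)
(* equivalence relation that it generates.                                    *)
Definition glue xi eta : rel point3 :=
  relU (rel_img upper (same_block xi)) (rel_img lower (same_block eta)).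

Definition prod_rel xi eta : rel point :=
  fun x y => connect (glue xi eta) (outer x) (outer y).

Lemma same_block_equiv xi : equivalence_rel (same_block xi).
Proof.
move=> x y z.
by have := pblock_equivalence (blocksP xi) (in_setT x) (in_setT y) (in_setT z).
Qed.

Lemma same_block_refl xi : reflexive (same_block xi).
Proof. by move=> x; case: (same_block_equiv xi x x x). Qed.

Lemma same_block_sym xi : symmetric (same_block xi).
Proof.
move=> x y; apply/idP/idP => h.
  by have [_ <-] := same_block_equiv xi x y x; rewrite ?same_block_refl.
by have [_ <-] := same_block_equiv xi y x y; rewrite ?same_block_refl.
Qed.

Lemma glue_sym xi eta : symmetric (glue xi eta).
Proof.
move=> z w; rewrite /glue /=; congr (_ || _);
  exact: (rel_img_sym _ (@same_block_sym _)).
Qed.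

Lemma prod_rel_equiv xi eta : {in [set: point] & &, equivalence_rel (prod_rel xi eta)}.
Proof.
move=> x y z _ _ _; split; first exact: connect0.
move=> xy; exact: (same_connect (sym_connect_sym (glue_sym xi eta)) xy).
Qed.

Definition partition_mul xi eta : partition_semigroup :=
  PartitionSemigroup (equivalence_partitionP (prod_rel_equiv xi eta)).

Lemma same_block_mul xi eta : same_block (partition_mul xi eta) =2 prod_rel xi eta.
Proof.
move=> x y; rewrite /same_block.
exact: (pblock_equivalence_partition (prod_rel_equiv xi eta) (in_setT x) (in_setT y)).
Qed.

Lemma same_block_inj xi eta : same_block xi =2 same_block eta -> xi = eta.
Proof.
move=> h; apply: val_inj; rewrite /= -(equivalence_partition_pblock (blocksP xi)).
rewrite -(equivalence_partition_pblock (blocksP eta)).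
apply: eq_imset => x; apply/setP=> y; rewrite !inE; exact: h.
Qed.

Let point4 : finType := (point3 + 'I_n)%type.
Let i023 (z : point3) : point4 :=
  match z with
  | inl (inl k) => inl (inl (inl k)) | inl (inr k) => inl (inr k) | inr k => inr k
  end.
Let i013 (z : point3) : point4 :=
  match z with
  | inl (inl k) => inl (inl (inl k)) | inl (inr k) => inl (inl (inr k))
  | inr k => inr k
  end.
Let i123 (z : point3) : point4 :=
  match z with
  | inl (inl k) => inl (inl (inr k)) | inl (inr k) => inl (inr k) | inr k => inr k
  end.

Lemma partition_mulA : associative partition_mul.
Proof.
move=> xi eta zeta; apply: same_block_inj => x y; rewrite !same_block_mul /prod_rel.
pose u01 (p : point) : point4 := inl (upper p).
pose u12 (p : point) : point4 := inl (lower p).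
pose u23 (p : point) : point4 := i023 (lower p).
pose E := relU (relU (rel_img u01 (same_block xi)) (rel_img u12 (same_block eta)))
               (rel_img u23 (same_block zeta)).
pose o (p : point) : point4 := i023 (outer p).
transitivity (connect E (o x) (o y)).
  pose F := relU (rel_img lower [rel c c' | connect (glue eta zeta) (outer c) (outer c')])
                 (rel_img upper (same_block xi)).
  transitivity (connect F (outer x) (outer y)).
    apply: eq_connect => z w; rewrite /glue /F /= orbC; congr (_ || _).
    by apply/rel_imgP/rel_imgP => -[a [b [ab -> ->]]]; exists a, b; split=> //;
      move: ab; rewrite same_block_mul.
  rewrite -(@connect_contract _ _ point4 _ i013 i123 outer lower); first last.
  - by case=> [[k|k]|k] [[k'|k']|k'] //= [->]; [exists (inl k') | exists (inr k')].
  - by case.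
  - by case=> [[k|k]|k] [[k'|k']|k'] //= [->].
  - by case=> [[k|k]|k] [[k'|k']|k'] //= [->].
  have -> : i013 (outer x) = o x by case: x.
  have -> : i013 (outer y) = o y by case: y.
  apply: eq_connect => z w; rewrite /E /=.
  rewrite -[rel_img i123 _ _ _]/(rel_img i123 (relU _ _) z w) rel_imgU /= !rel_img_comp.
  rewrite orbC orbA; congr (_ || _ || _); apply: eq_rel_img; by case.
pose F := relU (rel_img upper [rel c c' | connect (glue xi eta) (outer c) (outer c')])
               (rel_img lower (same_block zeta)).
transitivity (connect F (outer x) (outer y)); last first.
  apply: eq_connect => z w; rewrite /glue /F /=; congr (_ || _).
  by apply/rel_imgP/rel_imgP => -[a [b [ab -> ->]]]; exists a, b; split=> //;
    move: ab; rewrite same_block_mul.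
rewrite -(@connect_contract _ _ point4 _ i023 inl outer upper); first last.
- by case=> [[k|k]|k] [[k'|k']|k'] //= [->]; [exists (inl k') | exists (inr k')].
- by case.
- by move=> a b [].
- by case=> [[k|k]|k] [[k'|k']|k'] //= [->].
apply: eq_connect => z w; rewrite /E /=.
rewrite -[rel_img inl _ _ _]/(rel_img inl (relU _ _) z w) rel_imgU /= !rel_img_comp.
by congr (_ || _ || _); apply: eq_rel_img; case.
Qed.

HB.instance Definition _ := isSemigroup.Build partition_semigroup partition_mulA.

End PartitionSemigroup.

Lemma half_lt N : (1 < N -> 0 < N./2 < N)%N.
Proof. lia. Qed.

Lemma subn_half_even N : ~~ odd N -> (N - N./2 = N./2)%N.
Proof. lia. Qed.

Lemma subn_half_odd N : odd N -> (N - (N./2).+1 = N./2)%N.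
Proof. lia. Qed.

Lemma subn_eq_half N i :
  (0 < i < N)%N -> (N - i == i)%N || (N - i.+1 == i)%N -> i = N./2.
Proof. lia. Qed.

Section TwoInvolutions.
Variables (Z : finType) (F G : Z -> Z).
Hypotheses (FK : involutive F) (GK : involutive G).

Let e := [rel z w | (w == F z) || (w == G z)].
Let h z := F (G z).
Let h_inj : injective h.
Proof. exact: inj_comp (inv_inj FK) (inv_inj GK). Qed.

(* If u is fixed by F only, its component in the graph of F and G is a path,  *)
(* which has exactly one other end.                                           *)
Lemma two_involutions u : F u = u -> G u != u ->
  exists v, [/\ v != u, connect e u v, (F v == v) || (G v == v)
    & forall w, connect e u w -> (F w == w) || (G w == w) -> w = u \/ w = v].
Proof.
move=> Fu Gu; pose a i := iter i h u; pose N := fingraph.order h u.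
have N0 : (0 < N)%N := fingraph.order_gt0 h u.
have aN : a N = u := iter_order h_inj u.
have ainj i k : (i < N)%N -> (k < N)%N -> a i = a k -> i = k.
  by move=> iN kN E; rewrite -(findex_iter iN) -(findex_iter kN) -/(a i) E.
have Fa i : (i <= N)%N -> F (a i) = a (N - i)%N.
  elim: i => [|i IH] iN; first by rewrite subn0 aN /a /= Fu.
  have E : (N - i)%N = (N - i.+1)%N.+1 by rewrite -subSn.
  have : F (a i) = F (G (a (N - i.+1)%N)) by rewrite IH ?E // ltnW.
  by move/(inv_inj FK) => ai; rewrite {1}/a iterS -/(a i) ai /h FK GK.
have Ga i : (i < N)%N -> G (a i) = a (N - i.+1)%N.
  by move=> iN; rewrite -Fa // /a iterS /h FK.
have conn w : connect e u w -> exists2 i, (i < N)%N & w = a i.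
  have step z : (exists2 i, (i < N)%N & z = a i) -> forall z', e z z' ->
      exists2 i, (i < N)%N & z' = a i.
    case=> i iN -> z' /orP[] /eqP ->; last by rewrite Ga //; exists (N - i.+1)%N => //; rewrite ltn_subrL.
    case: i iN => [|i] iN; first by exists 0%N; rewrite // /a /= Fu.
    by exists (N - i.+1)%N; rewrite ?ltn_subrL ?Fa // ltnW.
  have walk p : forall x, (exists2 i, (i < N)%N & x = a i) -> path e x p ->
      exists2 i, (i < N)%N & last x p = a i.
    elim: p => [|z p IHp] x xa //= /andP[exz pth].
    by apply: IHp pth; apply: step exz.
  by case/connectP=> p pth ->; apply: walk pth; exists 0%N.
clearbody N.
have N1 : (1 < N)%N.
  rewrite ltn_neqAle N0 andbT; apply: contraNneq Gu => N1; apply/eqP.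
  by move: (Ga 0%N N0); rewrite -N1 /a.
have hN : (0 < N./2 < N)%N := half_lt N1.
case/andP: hN => h0 hN; exists (a N./2); split.
- by apply/eqP => /(ainj _ 0%N hN N0) E; rewrite E in h0.
- rewrite /a; elim: (N./2) => [|i IH]; first exact: connect0.
  apply: connect_trans IH (@connect_trans _ _ (G (iter i h u)) _ _ _ _).
    by apply: connect1; rewrite /= eqxx orbT.
  by apply: connect1; rewrite /= eqxx.
- have [oN|eN] := boolP (odd N).
    by apply/orP; right; rewrite (Ga _ hN) subn_half_odd.
  by apply/orP; left; rewrite (Fa _ (ltnW hN)) subn_half_even.
move=> w /conn[i iN ->]; case: (posnP i) => [->|i0]; first by left.
have Ni : (N - i < N)%N by rewrite ltn_subrL i0 N0.
have Ni1 : (N - i.+1 < N)%N by rewrite ltn_subrL N0.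
move=> fixi; right; rewrite (@subn_eq_half N i) ?i0 //.
case/orP: fixi => /eqP.
  by rewrite (Fa _ (ltnW iN)) => /(ainj _ _ Ni iN) ->; rewrite eqxx.
by rewrite (Ga _ iN) => /(ainj _ _ Ni1 iN) ->; rewrite eqxx orbT.
Qed.

End TwoInvolutions.

Section Brauer.
Variable n : nat.
Notation pt := (point n).
Implicit Types xi eta : partition_semigroup n.

Definition all_pairs : pred (partition_semigroup n) :=
  fun xi => [forall B in blocks xi, #|B| == 2].

Lemma all_pairsP xi : all_pairs xi ->
  exists f : pt -> pt, [/\ involutive f, forall x, f x != x
    & forall x y, same_block xi x y = (y == x) || (y == f x)].
Proof.
move=> /forall_inP pairs.
have ex x : exists y, (y != x) && same_block xi x y.
  have : #|pblock (blocks xi) x| == 2.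
    apply: pairs; apply: pblock_mem.
    by rewrite (cover_partition (blocksP xi)) in_setT.
  rewrite (cardsD1 x) -/(same_block xi x x) same_block_refl add1n eqSS.
  by case/cards1P=> y yE; exists y; have := set11 y; rewrite -yE !inE.
pose f x := xchoose (ex x).
have fP x : (f x != x) && same_block xi x (f x) := xchooseP (ex x).
have sE x y : same_block xi x y = (y == x) || (y == f x).
  have /andP[fx sx] := fP x.
  apply/idP/orP => [sxy|[] /eqP-> //]; last by rewrite same_block_refl.
  have : #|pblock (blocks xi) x| == 2.
    apply: pairs; apply: pblock_mem.
    by rewrite (cover_partition (blocksP xi)) in_setT.
  rewrite (cardsD1 x) -/(same_block xi x x) same_block_refl add1n eqSS.
  case: (eqVneq y x) => [_|yx]; [by left | right].
  case/cards1P: H => z zE.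
  have: y \in [set z] by rewrite -zE !inE yx.
  have: f x \in [set z] by rewrite -zE !inE fx.
  by rewrite !inE => /eqP -> /eqP ->.
exists f; split=> // [x|x]; last by case/andP: (fP x).
have /andP[fx sx] := fP x; move: sx; rewrite same_block_sym sE eq_sym (negPf fx) /=.
by move/eqP.
Qed.

Lemma all_pairs_mul : mulg_closed all_pairs.
Proof.
move=> xi eta /all_pairsP[f [fK fne fE]] /all_pairsP[g [gK gne gE]].
pose F (z : point3 n) : point3 n := if z is inl x then upper (f x) else z.
pose G (z : point3 n) : point3 n :=
  match z with
  | inl (inl a) => z
  | inl (inr b) => lower (g (inl b))
  | inr c => lower (g (inr c))
  end.
have GE x : G (lower x) = lower (g x) by case: x.
have FK : involutive F by case=> [x|c] //=; rewrite /upper fK.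
have GK : involutive G by case=> [[a|b]|c] //; rewrite /= GE gK.
have glueE : connect (glue xi eta) =2 connect [rel z w | (w == F z) || (w == G z)].
  have sub1 : subrel (connect (glue xi eta)) (connect [rel z w | (w == F z) || (w == G z)]).
    apply: connect_sub => z w /orP[] /rel_imgP[x [y [sxy -> ->]]].
      move: sxy; rewrite fE => /orP[] /eqP ->; first exact: connect0.
      by apply: connect1; rewrite /= eqxx.
    move: sxy; rewrite gE => /orP[] /eqP ->; first exact: connect0.
    by apply: connect1; rewrite /= GE eqxx orbT.
  move=> z w; apply/idP/idP; first exact: sub1.
  move: z w; apply: connect_sub => z w /orP[] /eqP ->.
    case: z => [x|c]; last exact: connect0.
    apply: connect1; apply/orP; left; apply/rel_imgP; exists x, (f x).
    by split=> //; rewrite fE eqxx orbT.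
  have lo x : connect (glue xi eta) (lower x) (G (lower x)).
    apply: connect1; apply/orP; right; apply/rel_imgP; exists x, (g x).
    by split=> //; rewrite gE eqxx orbT.
  by case: z => [[a|b]|c]; [exact: connect0 | exact: (lo (inl b)) | exact: (lo (inr c))].
have outer_inj : injective (@outer n) by case=> [a|a] [b|b] //= [->].
have fixE z : (F z == z) || (G z == z) <-> exists x, z = outer x.
  split; last by case=> -[a|a] -> /=; rewrite eqxx ?orbT.
  case: z => [[a|b]|c] //=; [by exists (inl a) | | by exists (inr c)].
  case/orP=> /eqP.
    by case=> E; have := fne (inr b); rewrite E eqxx.
  rewrite -[inl (inr b)]/(lower (inl b)) => E.
  have := gne (inl b); rewrite (_ : g (inl b) = inl b) ?eqxx //.
  by case: (g (inl b)) E => k //= [->].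
have key x : exists2 y, y != x & forall w, prod_rel xi eta x w = (w == x) || (w == y).
  have [v [vu uv fv P]] : exists v, [/\ v != outer x,
      connect [rel z w | (w == F z) || (w == G z)] (outer x) v,
      (F v == v) || (G v == v)
    & forall w, connect [rel z w | (w == F z) || (w == G z)] (outer x) w ->
        (F w == w) || (G w == w) -> w = outer x \/ w = v].
    case: x => a.
      have [] := @two_involutions _ G F GK FK (outer (inl a)) erefl.
        by apply/eqP => -[E]; have := fne (inl a); rewrite E eqxx.
      move=> v [vu uv fv P].
      have cE : connect [rel z w | (w == G z) || (w == F z)]
           =2 connect [rel z w | (w == F z) || (w == G z)].
        by apply: eq_connect => z w /=; rewrite orbC.
      exists v; split=> //; [by rewrite -cE | by rewrite orbC|].
      by move=> w; rewrite -cE orbC; apply: P.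
    apply: two_involutions => //; apply/eqP; rewrite /= => E.
    have := gne (inr a); rewrite (_ : g (inr a) = inr a) ?eqxx //.
    by case: (g (inr a)) E => k //= [->].
  case/fixE: fv => y vE; subst v; exists y.
    by apply: contraNneq vu => ->.
  move=> w; rewrite /prod_rel glueE; apply/idP/orP.
    move/P; case; first by apply/fixE; exists w.
      by move/outer_inj->; left.
    by move/outer_inj->; right.
  by case=> /eqP ->.
apply/forall_inP => B; case/imsetP=> x _ ->; have [y yx yE] := key x.
suff -> : [set z in [set: pt] | prod_rel xi eta x z] = [set x; y].
  by rewrite cards2 (eq_sym x) yx.
by apply/setP=> w; rewrite !inE yE.
Qed.

Record brauer := Brauer { brauer_val : partition_semigroup n; _ : all_pairs brauer_val }.

HB.instance Definition _ := [isSub for brauer_val].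
HB.instance Definition _ := [Finite of brauer by <:].
HB.instance Definition _ :=
  SubChoice_isSubSemigroup.Build _ all_pairs brauer all_pairs_mul.

End Brauer.

(* Main.v *)
From HB Require Import structures.
Require Import Defs.
From mathcomp Require Import all_boot.
From mathcomp Require Import fingroup perm zify.

Set Implicit Arguments.
Unset Strict Implicit.
Unset Printing Implicit Defensive.

(** Multiplying on the right by generators turns a semigroup into an automaton,
    and an iterated wreath product is a cascade of automata in which each layer
    reads the states of the layers below it.  Write B_N for the Brauer monoid
    and rank for the number of blocks that join the two rows.  The ranks are
    N, N - 2, N - 4 and so on, and the elements of rank r that share their
    horizontal arcs with a given idempotent form a symmetric group of degree r.
    So n ranks of B_2n and of B_2n+1 carry non-trivial groups, and the claim is
    that each of them costs exactly one group layer.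

    Upper bound (complexity_upper_bound).  A cascade follows a product p of
    letters through shrinking left ideals S u, with u one rank lower at each
    layer, so that p = y u for some y.  Suppose a letter s sends S u into S u'.
    Then u s = q u' with q in the corner e S e of the current rank: either q is
    a permutation, which the group coordinate of the layer absorbs, or q
    factors through the next rank, and then the whole of S u s lies in one known
    smaller left ideal, so that a reset suffices (tracks_refine).  At the bottom
    of B_2n+1 the corner of rank 1 is trivial, its ideal is a rectangular band,
    and an aperiodic layer can follow p itself (tracks_last).  This is one group
    layer for each of the ranks 2n + 1, ..., 5, 3.

    Lower bound (complexity_lower_bound).  Let T act through its images in the
    layers of an iterated wreath product, and let T also map onto B_2m.  In
    an aperiodic layer over a state that is already fixed, the lift of the
    permutations acts trivially on a suitable state, and one more reset makes
    the lifts of all the generators, permutations and one idempotent, fix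
    it (aperiodic_step).  In a group layer over a fixed state every
    idempotent acts as the identity, hence so does everything that idempotents
    generate; in B_2m this includes a copy of B_2m-2 (lift_idem_gen).  So each
    group layer lowers m by one only (kr_product_fixed).  If B_2n divided
    a product with fewer than n group layers, some non-trivial permutation
    would be left in the end, fixing by right multiplication the identity
    element of its own group.

    Finally B_2n embeds in B_2n+1, so the lower bound for the former and
    the upper bound for the latter hold for both. *)

Local Open Scope group_scope.

(** * Idempotents and groups in finite semigroups *)

Section Gen.
Variable T : finSemigroupType.
Implicit Types (A D : {set T}) (x y z : T).

(** Reaching the products of letters of A by right multiplication makes
    membership in the generated subsemigroup decidable. *)
Definition sgen A : {set T} :=
  [set z | [exists a in A, connect [rel x y | [exists b in A, y == x * b]] a z]].

Lemma mem_sgen A x : x \in A -> x \in sgen A.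
Proof. by move=> xA; rewrite inE; apply/exists_inP; exists x. Qed.

Lemma sgen_mulr A x b : x \in sgen A -> b \in A -> x * b \in sgen A.
Proof.
rewrite !inE => /exists_inP[a aA ax] bA; apply/exists_inP; exists a => //.
by apply: connect_trans ax (connect1 _); apply/exists_inP; exists b.
Qed.

Lemma sgen_ind A (P : T -> Prop) :
  (forall a, a \in A -> P a) ->
  (forall x b, x \in sgen A -> P x -> b \in A -> P (x * b)) ->
  forall x, x \in sgen A -> P x.
Proof.
move=> P1 PM x; rewrite inE => /exists_inP[a aA /connectP[p]].
elim: p a {aA}(P1 _ aA) (mem_sgen aA) => [|y p IHp] a Pa ga /=; first by move=> _ ->.
case/andP=> /exists_inP[b bA /eqP->] pth xE.
by apply: IHp pth xE; [apply: PM | apply: sgen_mulr].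
Qed.

Lemma sgen_closed A : mulg_closed (sgen A).
Proof.
move=> x y xA yA; elim/sgen_ind: y / yA => [a aA|y b _ xy bA]; first exact: sgen_mulr.
by rewrite mulgA sgen_mulr.
Qed.

Lemma sgen_sub A D : mulg_closed D -> A \subset D -> sgen A \subset D.
Proof.
move=> cD /subsetP sAD; apply/subsetP => x; elim/sgen_ind => [a /sAD//|y b _ yD /sAD bD].
exact: cD.
Qed.

(** In a non-empty subsemigroup D of least cardinality, x D is D, so the
    subsemigroup of the y with x y = x is non-empty, hence contains x. *)
Lemma closed_has_idem D x : mulg_closed D -> x \in D ->
  exists2 e, e \in D & e * e = e.
Proof.
have [k] := ubnP #|D|; elim: k D x => // k IHk D x leDk cD xD.
have cxD : mulg_closed [set x * y | y in D].
  move=> _ _ /imsetP[y yD ->] /imsetP[z zD ->].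
  by rewrite -mulgA imset_f // !cD.
have sxD : [set x * y | y in D] \subset D.
  by apply/subsetP => _ /imsetP[y yD ->]; apply: cD.
have [xDD|nxD] := boolP (x \in [set x * y | y in D]); last first.
  have ltc : #|[set x * y | y in D]| < #|D|.
    by apply/proper_card/properP; split=> //; exists x.
  have [|e] := IHk _ (x * x) (leq_trans ltc _) cxD (imset_f _ xD); first by [].
  by move=> /(subsetP sxD) eD ee; exists e.
pose C := [set y in D | x * y == x].
have cC : mulg_closed C.
  move=> y z; rewrite !inE => /andP[yD /eqP xy] /andP[zD /eqP xz].
  by rewrite cD //= mulgA xy xz.
case/imsetP: xDD => y yD xE.
have yC : y \in C by rewrite inE yD -xE eqxx.
have sCD : C \subset D by apply/subsetP => z; rewrite inE => /andP[].
have [xC|nxC] := boolP (x \in C).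
  by exists x => //; move: xC; rewrite inE => /andP[_ /eqP].
have ltc : #|C| < #|D| by apply/proper_card/properP; split=> //; exists x.
have [|e] := IHk C y (leq_trans ltc _) cC yC; first by [].
by move=> /(subsetP sCD) eD ee; exists e.
Qed.

(** Every element of the local monoid z D z is right invertible, so this monoid
    is a group.  The idempotent z minimises z D z: an idempotent f of t (z D z)
    satisfies z f = f z = f, so f D f is contained in z D z, the two are equal,
    and f = z.  Groups that lift a group of units are found in this way. *)
Lemma closed_has_local_group D x : mulg_closed D -> x \in D ->
  exists z, [/\ z \in D, z * z = z
    & forall t, t \in D -> z * t = t -> t * z = t ->
        exists k, [/\ k \in D, z * k = k, k * z = k & t * k = z]].
Proof.
move=> cD xD; have [e0 e0D e0e0] := closed_has_idem cD xD.
pose L z := [set z * t * z | t in D].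
pose P z := (z \in D) && (z * z == z).
have P0 : P e0 by rewrite /P e0D e0e0 /=.
case: (arg_minnP (fun z => #|L z|) P0) => z /andP[zD /eqP zz] zmin.
exists z; split=> // t tD zt tz.
pose C := [set t * (z * k * z) | k in D].
have cC : mulg_closed C.
  move=> _ _ /imsetP[k kD ->] /imsetP[l lD ->].
  have -> : t * (z * k * z) * (t * (z * l * z)) = t * (z * (k * z * t * z * l) * z).
    by rewrite !mulgA.
  by apply: imset_f; rewrite !cD.
have [f fC ff] := closed_has_idem cC (imset_f _ zD).
case/imsetP: (fC) => k kD fE.
have fD : f \in D by rewrite fE !cD.
have zf : z * f = f by rewrite fE !mulgA zt.
have fz : f * z = f by rewrite fE -!mulgA zz.
have sL : L f \subset L z.
  apply/subsetP => _ /imsetP[u uD ->].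
  have -> : f * u * f = z * (f * u * f) * z.
    have -> : z * (f * u * f) * z = z * f * u * (f * z) by rewrite !mulgA.
    by rewrite zf fz.
  by apply: imset_f; rewrite !cD.
have /eqP LE : L f == L z.
  by rewrite eqEcard sL /= zmin // /P fD ff /=.
have zL : z \in L f by rewrite LE; apply/imsetP; exists z; rewrite ?zz.
have fzE : f = z.
  case/imsetP: zL => u uD zE.
  have : f * z = z by rewrite {1}zE !mulgA ff -zE.
  by rewrite fz.
exists (z * k * z); split; first by rewrite !cD.
- by rewrite !mulgA zz.
- by rewrite -!mulgA zz.
by rewrite -fE.
Qed.

End Gen.

(** * Brauer elements as fixed-point-free involutions *)

Lemma connect_homo (X Y : finType) (f : X -> Y) (e : rel X) (e' : rel Y) :
  {homo f : u v / e u v >-> e' u v} ->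
  {homo f : u v / connect e u v >-> connect e' u v}.
Proof.
move=> h u v /connectP[p]; elim: p u => [|w p IHp] u /=.
  by move=> _ ->; exact: connect0.
by case/andP=> /h euw pth lst; apply: connect_trans (connect1 euw) (IHp _ pth lst).
Qed.

Section Mate.
Variable n : nat.
Implicit Types (x y : brauer n) (p q : point n).

(** The other point of the block of p; the default value is never reached. *)
Definition mate x p : point n :=
  odflt p [pick q | (q != p) && same_block (brauer_val x) p q].

Lemma mate_spec x : [/\ involutive (mate x), forall p, mate x p != p
  & forall p q, same_block (brauer_val x) p q = (q == p) || (q == mate x p)].
Proof.
have [f [fK fne fE]] := all_pairsP (valP x).
have mE : mate x =1 f.
  move=> p; rewrite /mate; case: pickP => [q|/(_ (f p))] /=.
    by rewrite fE => /andP[/negPf->] /eqP.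
  by rewrite fE fne eqxx orbT.
by split=> [p|p|p q]; rewrite !mE ?fK ?fne ?fE.
Qed.

Lemma mateK x : involutive (mate x). Proof. by case: (mate_spec x). Qed.
Lemma mate_neq x p : mate x p != p. Proof. by case: (mate_spec x). Qed.
Lemma same_blockE x p q :
  same_block (brauer_val x) p q = (q == p) || (q == mate x p).
Proof. by case: (mate_spec x). Qed.

Lemma mate_inj x y : mate x =1 mate y -> x = y.
Proof.
by move=> h; apply/val_inj/same_block_inj => p q; rewrite !same_blockE h.
Qed.

Lemma brauer_with_mate (f : point n -> point n) :
  involutive f -> (forall p, f p != p) -> exists x, mate x =1 f.
Proof.
move=> fK fne; pose R := [rel p q | (q == p) || (q == f p)].
have Rt p q : R p q -> R q =1 R p.
  move=> /orP[] /eqP -> r //=; rewrite fK orbC //.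
have Req : {in [set: point n] & &, equivalence_rel R}.
  by move=> p q r _ _ _; split=> [|h]; [rewrite /= eqxx | exact: esym (Rt _ _ h r)].
pose xi := PartitionSemigroup (equivalence_partitionP Req).
have xiE p q : same_block xi p q = R p q.
  exact: (pblock_equivalence_partition Req (in_setT p) (in_setT q)).
have xi2 : all_pairs xi.
  apply/forall_inP => B /imsetP[p _ ->].
  suff -> : [set q in [set: point n] | R p q] = [set p; f p].
    by rewrite cards2 (eq_sym p) (negPf (fne p)).
  by apply/setP=> q; rewrite !inE.
exists (Brauer xi2) => p; have := same_blockE (Brauer xi2) p (f p).
by rewrite xiE /= eqxx orbT (negPf (fne p)) => /esym/eqP.
Qed.

Lemma brauer_of_involution (f : point n -> point n) :
  involutive f -> (forall p, f p != p) -> {x | mate x =1 f}.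
Proof.
move=> fK fne; case: (pickP [pred x | [forall p, mate x p == f p]]).
  by move=> x /forallP h; exists x => p; apply/eqP.
move=> h; exfalso; have [x xE] := brauer_with_mate fK fne.
by move: (h x) => /= /negbT/negP; apply; apply/forallP => p; rewrite xE.
Qed.

Lemma glue_upper x y p :
  connect (glue (brauer_val x) (brauer_val y)) (upper p) (upper (mate x p)).
Proof.
apply: connect1; apply/orP; left; apply/rel_imgP; exists p, (mate x p).
by rewrite same_blockE eqxx orbT.
Qed.

Lemma glue_lower x y p :
  connect (glue (brauer_val x) (brauer_val y)) (lower p) (lower (mate y p)).
Proof.
apply: connect1; apply/orP; right; apply/rel_imgP; exists p, (mate y p).
by rewrite same_blockE eqxx orbT.
Qed.

(** Blocks of a product have two elements, so a single path in the glued
    diagram determines a block. *)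
Lemma mate_mul x y p q : q != p ->
  connect (glue (brauer_val x) (brauer_val y)) (outer p) (outer q) ->
  mate (x * y) p = q.
Proof.
move=> qp h; have := same_blockE (x * y) p q.
by rewrite same_block_mul /prod_rel h (negPf qp) /= => /esym/eqP.
Qed.

Lemma mate_mul_connect x y p :
  connect (glue (brauer_val x) (brauer_val y)) (outer p) (outer (mate (x * y) p)).
Proof.
have := same_blockE (x * y) p (mate (x * y) p).
by rewrite same_block_mul eqxx orbT.
Qed.

End Mate.

(** * Permutations and juxtaposition of diagrams *)

Section Perm.
Variable n : nat.
Implicit Types (x y : brauer n) (p q : point n) (s t : 'S_n).

Definition perm_mate s p : point n :=
  match p with inl i => inr (s i) | inr i => inl (s^-1 i) end.

Lemma perm_mateK s : involutive (perm_mate s).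
Proof. by case=> i /=; rewrite ?permK ?permKV. Qed.

Lemma perm_mate_neq s p : perm_mate s p != p. Proof. by case: p. Qed.

Definition of_perm s : brauer n :=
  sval (brauer_of_involution (@perm_mateK s) (@perm_mate_neq s)).

Lemma mate_of_perm s : mate (of_perm s) =1 perm_mate s.
Proof. by rewrite /of_perm; case: brauer_of_involution. Qed.

Lemma of_perm_inj : injective of_perm.
Proof.
move=> s t st; apply/permP => i; have := mate_of_perm s (inl i).
by rewrite st mate_of_perm => -[].
Qed.

(** The effect on points of multiplying by permutations on both sides. *)
Definition relabel s t p : point n :=
  match p with inl i => inl (s^-1 i) | inr i => inr (t i) end.

Lemma relabelK s t : cancel (relabel s t) (relabel s^-1 t^-1).
Proof. by case=> i /=; rewrite ?permK ?permKV ?invgK. Qed.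

Lemma relabelKV s t : cancel (relabel s^-1 t^-1) (relabel s t).
Proof. by case=> i /=; rewrite ?permK ?permKV ?invgK ?permK ?permKV. Qed.

Lemma mate_mul_of_perm x t p :
  mate (x * of_perm t) (relabel 1 t p) = relabel 1 t (mate x p).
Proof.
have path q : connect (glue (brauer_val x) (brauer_val (of_perm t)))
    (outer (relabel 1 t q)) (upper q).
  case: q => i /=; first by rewrite invg1 perm1; exact: connect0.
  by have := glue_lower x (of_perm t) (inr (t i)); rewrite mate_of_perm /= permK.
apply: mate_mul; first by rewrite (can_eq (relabelK 1 t)) mate_neq.
apply: connect_trans (path _) (connect_trans (glue_upper _ _ _) _).
by rewrite (sym_connect_sym (@glue_sym _ _ _)) path.
Qed.

Lemma mate_of_perm_mul s x p :
  mate (of_perm s * x) (relabel s 1 p) = relabel s 1 (mate x p).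
Proof.
have path q : connect (glue (brauer_val (of_perm s)) (brauer_val x))
    (outer (relabel s 1 q)) (lower q).
  case: q => i /=; last by rewrite perm1; exact: connect0.
  by have := glue_upper (of_perm s) x (inl (s^-1 i)); rewrite mate_of_perm /= permKV.
apply: mate_mul; first by rewrite (can_eq (relabelK s 1)) mate_neq.
apply: connect_trans (path _) (connect_trans (glue_lower _ _ _) _).
by rewrite (sym_connect_sym (@glue_sym _ _ _)) path.
Qed.

Lemma mate_conj_of_perm s x t p :
  mate (of_perm s * x * of_perm t) (relabel s t p) = relabel s t (mate x p).
Proof.
have E q : relabel s t q = relabel 1 t (relabel s 1 q).
  by case: q => i /=; rewrite ?invg1 ?perm1.
by rewrite !E mate_mul_of_perm mate_of_perm_mul.
Qed.

Lemma of_perm1_mul x : of_perm 1 * x = x.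
Proof.
apply: mate_inj => p; have E q : relabel 1 1 q = q :> point n.
  by case: q => i /=; rewrite ?invg1 perm1.
by have := mate_of_perm_mul 1 x p; rewrite !E.
Qed.

Lemma mul_of_perm1 x : x * of_perm 1 = x.
Proof.
apply: mate_inj => p; have E q : relabel 1 1 q = q :> point n.
  by case: q => i /=; rewrite ?invg1 perm1.
by have := mate_mul_of_perm x 1 p; rewrite !E.
Qed.

Lemma of_permM s t : of_perm (s * t) = of_perm s * of_perm t.
Proof.
apply: mate_inj => p; rewrite -(relabelKV 1 t p) mate_mul_of_perm !mate_of_perm.
by case: (relabel _ _ p) => i /=; rewrite ?permM ?invg1 ?perm1 // invMg permM permK.
Qed.

Lemma of_permVK s x : of_perm s^-1 * (of_perm s * x) = x.
Proof. by rewrite mulgA -of_permM mulVg of_perm1_mul. Qed.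

End Perm.

Section Oplus.
Variables a b : nat.
Implicit Types (x : brauer a) (y : brauer b) (p : point (a + b)).

Definition inl_pt (p : point a) : point (a + b) :=
  match p with inl i => inl (lshift b i) | inr i => inr (lshift b i) end.
Definition inr_pt (p : point b) : point (a + b) :=
  match p with inl i => inl (rshift a i) | inr i => inr (rshift a i) end.

Definition split_pt p : point a + point b :=
  match p with
  | inl i => match split i with inl k => inl (inl k) | inr k => inr (inl k) end
  | inr i => match split i with inl k => inl (inr k) | inr k => inr (inr k) end
  end.

Lemma split_inl q : split_pt (inl_pt q) = inl q.
Proof. by case: q => i /=; rewrite (unsplitK (inl i)). Qed.
Lemma split_inr q : split_pt (inr_pt q) = inr q.
Proof. by case: q => i /=; rewrite (unsplitK (inr i)). Qed.

Variant split_pt_spec p : Type :=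
| SplitInl q of p = inl_pt q
| SplitInr q of p = inr_pt q.

Lemma split_ptP p : split_pt_spec p.
Proof.
case: p => i; rewrite -(splitK i); case: (split i) => k /=.
- exact: (@SplitInl _ (inl k)).
- exact: (@SplitInr _ (inl k)).
- exact: (@SplitInl _ (inr k)).
- exact: (@SplitInr _ (inr k)).
Qed.

Definition oplus_mate x y p : point (a + b) :=
  match split_pt p with inl q => inl_pt (mate x q) | inr q => inr_pt (mate y q) end.

Lemma oplus_mateK x y : involutive (oplus_mate x y).
Proof.
move=> p; rewrite /oplus_mate.
by case: (split_ptP p) => q ->; rewrite ?split_inl ?split_inr ?split_inl ?split_inr mateK.
Qed.

Lemma inl_pt_inj : injective inl_pt.
Proof. by move=> p q /(congr1 split_pt); rewrite !split_inl => -[]. Qed.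
Lemma inr_pt_inj : injective inr_pt.
Proof. by move=> p q /(congr1 split_pt); rewrite !split_inr => -[]. Qed.

Lemma oplus_mate_neq x y p : oplus_mate x y p != p.
Proof.
rewrite /oplus_mate; case: (split_ptP p) => q ->; rewrite ?split_inl ?split_inr.
  by rewrite (inj_eq inl_pt_inj) mate_neq.
by rewrite (inj_eq inr_pt_inj) mate_neq.
Qed.

(** The tensor product of the Brauer category: diagrams drawn side by side. *)
Definition oplus x y : brauer (a + b) :=
  sval (brauer_of_involution (@oplus_mateK x y) (@oplus_mate_neq x y)).

Lemma mate_oplus x y : mate (oplus x y) =1 oplus_mate x y.
Proof. by rewrite /oplus; case: brauer_of_involution. Qed.

Lemma mate_oplusl x y q : mate (oplus x y) (inl_pt q) = inl_pt (mate x q).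
Proof. by rewrite mate_oplus /oplus_mate split_inl. Qed.
Lemma mate_oplusr x y q : mate (oplus x y) (inr_pt q) = inr_pt (mate y q).
Proof. by rewrite mate_oplus /oplus_mate split_inr. Qed.

Definition inl_pt3 (p : point3 a) : point3 (a + b) :=
  match p with inl q => inl (inl_pt q) | inr i => inr (lshift b i) end.
Definition inr_pt3 (p : point3 b) : point3 (a + b) :=
  match p with inl q => inl (inr_pt q) | inr i => inr (rshift a i) end.

(** Paths in the glued diagrams of x, x' and of y, y' embed in that of their
    juxtapositions. *)
Lemma oplusM x x' y y' : oplus (x * x') (y * y') = oplus x y * oplus x' y'.
Proof.
apply: mate_inj => p; apply/esym; case: (split_ptP p) => q ->.
  rewrite mate_oplusl; apply: mate_mul; first by rewrite (inj_eq inl_pt_inj) mate_neq.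
  have E r : outer (inl_pt r) = inl_pt3 (outer r) by case: r.
  rewrite !E; have := mate_mul_connect x x' q.
  apply: connect_homo => u v /orP[] /rel_imgP[r [r' [+ -> ->]]]; rewrite same_blockE => h.
    apply/orP; left; apply/rel_imgP; exists (inl_pt r), (inl_pt r').
    by rewrite same_blockE mate_oplusl !(inj_eq inl_pt_inj).
  apply/orP; right; apply/rel_imgP; exists (inl_pt r), (inl_pt r').
  by rewrite same_blockE mate_oplusl !(inj_eq inl_pt_inj); split=> //;
    case: (r) (r') => k [].
rewrite mate_oplusr; apply: mate_mul; first by rewrite (inj_eq inr_pt_inj) mate_neq.
have E r : outer (inr_pt r) = inr_pt3 (outer r) by case: r.
rewrite !E; have := mate_mul_connect y y' q.
apply: connect_homo => u v /orP[] /rel_imgP[r [r' [+ -> ->]]]; rewrite same_blockE => h.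
  apply/orP; left; apply/rel_imgP; exists (inr_pt r), (inr_pt r').
  by rewrite same_blockE mate_oplusr !(inj_eq inr_pt_inj).
apply/orP; right; apply/rel_imgP; exists (inr_pt r), (inr_pt r').
by rewrite same_blockE mate_oplusr !(inj_eq inr_pt_inj); split=> //;
    case: (r) (r') => k [].
Qed.

Lemma oplus_injr x : injective (oplus x).
Proof.
move=> y y' E; apply: mate_inj => q; apply: inr_pt_inj.
by rewrite -!(mate_oplusr x) E.
Qed.

Definition perm_oplus_fun (s : 'S_a) (t : 'S_b) (i : 'I_(a + b)) : 'I_(a + b) :=
  match split i with inl k => lshift b (s k) | inr k => rshift a (t k) end.

Lemma perm_oplus_funK s t : cancel (perm_oplus_fun s t) (perm_oplus_fun s^-1 t^-1).
Proof.
move=> i; rewrite /perm_oplus_fun -[RHS]splitK; case: (split i) => k.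
  by rewrite (unsplitK (inl _)) permK.
by rewrite (unsplitK (inr _)) permK.
Qed.

Definition perm_oplus s t : 'S_(a + b) := perm (can_inj (perm_oplus_funK s t)).

Lemma perm_oplusl s t k : perm_oplus s t (lshift b k) = lshift b (s k).
Proof. by rewrite permE /perm_oplus_fun (unsplitK (inl _)). Qed.
Lemma perm_oplusr s t k : perm_oplus s t (rshift a k) = rshift a (t k).
Proof. by rewrite permE /perm_oplus_fun (unsplitK (inr _)). Qed.

Lemma oplus_of_perm s t : oplus (of_perm s) (of_perm t) = of_perm (perm_oplus s t).
Proof.
apply: mate_inj => p; case: (split_ptP p) => q ->.
  rewrite mate_oplusl !mate_of_perm; case: q => k /=; first by rewrite perm_oplusl.
  by congr inl; apply: (canRL (permK _)); rewrite perm_oplusl permKV.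
rewrite mate_oplusr !mate_of_perm; case: q => k /=; first by rewrite perm_oplusr.
by congr inl; apply: (canRL (permK _)); rewrite perm_oplusr permKV.
Qed.

End Oplus.

(** * Arcs, corners and generators *)

Lemma mate_mul_inl n (x y : brauer n) i j :
  mate x (inl i) = inl j -> mate (x * y) (inl i) = inl j.
Proof.
move=> xi; apply: mate_mul; first by rewrite -xi mate_neq.
by have := glue_upper x y (inl i); rewrite xi.
Qed.

Lemma mate_mul_inr n (x y : brauer n) i j :
  mate y (inr i) = inr j -> mate (x * y) (inr i) = inr j.
Proof.
move=> yi; apply: mate_mul; first by rewrite -yi mate_neq.
by have := glue_lower x y (inr i); rewrite yi.
Qed.

Lemma mate_mul_through n (x y : brauer n) i j k :
  mate x (inl i) = inr j -> mate y (inl j) = inr k -> mate (x * y) (inl i) = inr k.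
Proof.
move=> xi yj; apply: mate_mul => //.
have := glue_upper x y (inl i); rewrite xi => /connect_trans; apply.
by have := glue_lower x y (inl j); rewrite yj.
Qed.

(** The conditions determine x; up to conjugation by permutations there is one
    such diagram, the generator of rank n - 2. *)
Definition is_arc n (a b : 'I_n) (x : brauer n) :=
  [/\ mate x (inl a) = inl b, mate x (inr a) = inr b
    & forall i, i != a -> i != b -> mate x (inl i) = inr i].

Lemma is_arc_inj n (a b : 'I_n) x y : is_arc a b x -> is_arc a b y -> x = y.
Proof.
case=> xa xa' xi [ya ya' yi].
have xb : mate x (inl b) = inl a by rewrite -xa mateK.
have xb' : mate x (inr b) = inr a by rewrite -xa' mateK.
have yb : mate y (inl b) = inl a by rewrite -ya mateK.
have yb' : mate y (inr b) = inr a by rewrite -ya' mateK.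
apply: mate_inj; case=> i; case: (eqVneq i a) => [->|ia]; rewrite ?xa ?ya ?xa' ?ya' //;
  case: (eqVneq i b) => [->|ib]; rewrite ?xb ?xb' ?yb ?yb' //; first by rewrite xi ?yi.
by rewrite -[in LHS](xi i) // -[in RHS](yi i) // !mateK.
Qed.

Lemma is_arc_conj n (a b : 'I_n) x (s : 'S_n) :
  is_arc a b x -> is_arc (s a) (s b) (of_perm s^-1 * x * of_perm s).
Proof.
case=> xa xa' xi; have := mate_conj_of_perm s^-1 x s => H; split.
- by have := H (inl a); rewrite xa /= invgK.
- by have := H (inr a); rewrite xa'.
move=> i ia ib; have := H (inl (s^-1 i)); rewrite xi /= ?invgK ?permKV //.
  by apply: contraNneq ia => <-; rewrite permKV.
by apply: contraNneq ib => <-; rewrite permKV.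
Qed.

Lemma is_arc_idem n (a b : 'I_n) x : is_arc a b x -> x * x = x.
Proof.
move=> ax; apply: is_arc_inj (ax); case: ax => xa xa' xi; split.
- exact: mate_mul_inl.
- exact: mate_mul_inr.
by move=> i ia ib; apply: mate_mul_through (xi _ ia ib) (xi _ ia ib).
Qed.

Lemma all_through_of_perm n (x : brauer n) :
  (forall i j, mate x (inl i) != inl j) -> exists s, x = of_perm s.
Proof.
move=> H; pose f i := if mate x (inl i) is inr j then j else i.
have fE i : mate x (inl i) = inr (f i).
  by rewrite /f; case E: (mate x (inl i)) => [j|j] //; move: (H i j); rewrite E eqxx.
have f_inj : injective f.
  by move=> i j ij; have := fE i; rewrite ij -fE => /(can_inj (mateK x)) [].
exists (perm f_inj); apply: mate_inj; case=> k; rewrite mate_of_perm /=.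
  by rewrite fE permE.
by rewrite -{1}(permKV (perm f_inj) k) permE -fE mateK.
Qed.

(** The two rows have equally many arcs.  If the lower row had none, its points
    would be joined to distinct points of the upper row, hence to all of them. *)
Lemma lower_arc n (x : brauer n) i j : mate x (inl i) = inl j ->
  exists k l, mate x (inr k) = inr l.
Proof.
move=> xi; case: (boolP [exists k, exists l, mate x (inr k) == inr l]).
  by case/existsP=> k /existsP[l /eqP]; exists k, l.
rewrite negb_exists => /forallP H; exfalso.
pose f k := if mate x (inr k) is inl j then j else k.
have fE k : mate x (inr k) = inl (f k).
  rewrite /f; case E: (mate x (inr k)) => [l|l] //.
  by case/negP: (H k); apply/existsP; exists l; rewrite E.
have f_inj : injective f.
  by move=> k l kl; have := fE k; rewrite kl -fE => /(can_inj (mateK x)) [].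
have /codomP[k iE] : i \in codom f 
  by rewrite (subset_cardP _ (subset_predT _)) ?card_codom.
by move: xi; rewrite iE -fE mateK.
Qed.

Lemma perm_two_points n (a b c d : 'I_n) : a != b -> c != d ->
  exists s : 'S_n, s a = c /\ s b = d.
Proof.
move=> ab cd; exists (tperm a c * tperm (tperm a c b) d); rewrite !permM tpermL tpermL.
split=> //; apply: tpermD; last by rewrite eq_sym.
by rewrite -[X in _ != X](tpermL a c) (inj_eq perm_inj) eq_sym.
Qed.

(** The element of rank 0 of the monoid of degree 2, an arc in each row. *)
Definition cup_mate (p : point 2) : point 2 :=
  match p with inl i => inl (rev_ord i) | inr i => inr (rev_ord i) end.

Lemma cup_mateK : involutive cup_mate.
Proof. by case=> i /=; rewrite rev_ordK. Qed.

Lemma cup_mate_neq p : cup_mate p != p.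
Proof. by case: p => -[[|[|//]] lti]. Qed.

Definition cup : brauer 2 := sval (brauer_of_involution cup_mateK cup_mate_neq).

Lemma mate_cup : mate cup =1 cup_mate.
Proof. by rewrite /cup; case: brauer_of_involution. Qed.

Lemma cup_idem : cup * cup = cup.
Proof.
apply: mate_inj; case=> i; rewrite mate_cup /=.
  by rewrite (@mate_mul_inl _ _ _ _ (rev_ord i)) // mate_cup.
by rewrite (@mate_mul_inr _ _ _ _ (rev_ord i)) // mate_cup.
Qed.

Section Lift.
Variable r : nat.

(** An isomorphism of the monoid of degree r onto a corner of the monoid of
    degree r + 2, with identity element e_cup. *)
Definition lift_cup (y : brauer r) : brauer r.+2 := oplus cup y.

Lemma lift_cupM y z : lift_cup (y * z) = lift_cup y * lift_cup z.
Proof. by rewrite /lift_cup -{1}cup_idem oplusM. Qed.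

Lemma lift_cup_inj : injective lift_cup. Proof. exact: (@oplus_injr 2 r cup). Qed.

Definition e_cup : brauer r.+2 := lift_cup (of_perm 1).
Definition cup0 : 'I_r.+2 := lshift r (ord0 : 'I_2).
Definition cup1 : 'I_r.+2 := lshift r (ord_max : 'I_2).

Lemma cup01 : cup0 != cup1. Proof. by []. Qed.

Lemma mate_lift_inl y (i : 'I_2) :
  mate (lift_cup y) (inl (lshift r i)) = inl (lshift r (rev_ord i)).
Proof. by have := mate_oplusl cup y (inl i); rewrite mate_cup. Qed.

Lemma mate_lift_inr y (i : 'I_2) :
  mate (lift_cup y) (inr (lshift r i)) = inr (lshift r (rev_ord i)).
Proof. by have := mate_oplusl cup y (inr i); rewrite mate_cup. Qed.

Lemma rev0 : rev_ord (ord0 : 'I_2) = ord_max. Proof. exact: val_inj. Qed.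
Lemma rev1 : rev_ord (ord_max : 'I_2) = ord0. Proof. exact: val_inj. Qed.

Lemma ord_cupP (i : 'I_r.+2) : i != cup0 -> i != cup1 -> exists k : 'I_r, i = rshift 2 k.
Proof.
move=> n0 n1; have := splitK (m := 2) (n := r) i; 
  case: (split _) => k /= iE; last by exists k.
by move: n0 n1; rewrite -iE; case: k {iE} => -[|[|]].
Qed.

Lemma e_cup_arc : is_arc cup0 cup1 e_cup.
Proof.
split; first by rewrite mate_lift_inl rev0.
  by rewrite mate_lift_inr rev0.
move=> i n0 n1; have [k ->] := ord_cupP n0 n1.
have := mate_oplusr cup (of_perm 1) (inl k : point r).
by rewrite mate_of_perm /= perm1.
Qed.

Lemma e_cup_idem : e_cup * e_cup = e_cup. Proof. exact: is_arc_idem e_cup_arc. Qed.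

(** A diagram with these two arcs is the juxtaposition of the pair of arcs and
    of its restriction to the other points. *)
Lemma lift_cup_of_arcs (z : brauer r.+2) :
  mate z (inl cup0) = inl cup1 -> mate z (inr cup0) = inr cup1 ->
  exists y, z = lift_cup y.
Proof.
move=> z0 z0'; pose zz : brauer (2 + r) := z.
have zl q : mate zz (inl_pt r q) = inl_pt r (mate cup q).
  have z1 : mate zz (inl cup1) = inl cup0 by rewrite -[LHS](congr1 (mate z) z0) mateK.
  have z1' : mate zz (inr cup1) = inr cup0 by rewrite -[LHS](congr1 (mate z) z0') mateK.
  have c2 (i : 'I_2) : i = ord0 \/ i = ord_max.
    by case: i => -[|[|//]] lti; [left | right]; apply: val_inj.
  by rewrite mate_cup; case: q => i; case: (c2 i) => -> /=; rewrite ?rev0 ?rev1.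
pose f q := if split_pt (mate zz (inr_pt 2 q)) is inr q' then q' else q.
have fE q : mate zz (inr_pt 2 q) = inr_pt 2 (f q).
  rewrite /f; case: (split_ptP (mate zz (inr_pt 2 q))) => q' E; rewrite E ?split_inr //.
  have := congr1 (@split_pt 2 r) (mateK zz (inr_pt 2 q)).
  by rewrite E zl split_inl split_inr.
have fK : involutive f.
  by move=> q; apply: (@inr_pt_inj 2 r); rewrite -!fE mateK.
have fne q : f q != q.
  by rewrite -(inj_eq (@inr_pt_inj 2 r)) -fE mate_neq.
have [y yE] := brauer_with_mate fK fne; exists y; apply: mate_inj => p.
case: (split_ptP (p : point (2 + r))) => q ->.
  by rewrite [RHS](mate_oplusl cup y) -zl.
by rewrite [RHS](mate_oplusr cup y) yE -fE.
Qed.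

(** Multiplying by e_cup on the left imposes its upper arc, on the right its
    lower arc; so lift_cup fills the corner of e_cup. *)
Lemma e_cup_sandwich (x : brauer r.+2) : exists y, e_cup * x * e_cup = lift_cup y.
Proof.
have [e0 e0' _] := e_cup_arc; apply: lift_cup_of_arcs.
  by rewrite -mulgA; apply: mate_mul_inl.
exact: mate_mul_inr.
Qed.

(** An element with an upper arc has a lower arc too, and permutations bring
    both to the first two points of their rows. *)
Lemma brauer_decomposition (x : brauer r.+2) :
  (exists s, x = of_perm s) \/ exists s y t, x = of_perm s * lift_cup y * of_perm t.
Proof.
case: (boolP [forall i, forall j, mate x (inl i) != inl j]).
  by move/forallP=> H; left; apply: all_through_of_perm => i j; apply: (forallP (H i)).
rewrite negb_forall => /existsP[a]; rewrite negb_forall => /existsP[b /negPn/eqP ab].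
have [c [d cd]] := lower_arc ab; right.
have nab : a != b.
  by apply: contra_eqN ab => /eqP ->; apply: mate_neq.
have ncd : c != d.
  by apply: contra_eqN cd => /eqP ->; apply: mate_neq.
have [s [s0 s1]] := perm_two_points cup01 nab.
have [t [t0 t1]] := perm_two_points ncd cup01.
have [||y yE] := @lift_cup_of_arcs (of_perm s * x * of_perm t).
- have := mate_conj_of_perm s x t (inl a).
  by rewrite ab /= -s0 -s1 !permK.
- have := mate_conj_of_perm s x t (inr c).
  by rewrite cd /= t0 t1.
exists s^-1, y, t^-1; rewrite -yE -!mulgA of_permVK -of_permM mulgV mul_of_perm1 //.
Qed.

End Lift.

Lemma small_brauer r (x : brauer r) : r < 2 -> exists s, x = of_perm s.
Proof.
move=> r2; apply: all_through_of_perm => i j; apply/eqP => xi.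
have := mate_neq x (inl i); rewrite xi; apply/negP; rewrite negbK.
by apply/eqP; congr inl; apply: val_inj; case: i j {xi} => i lti [j ltj] /=; lia.
Qed.

Definition gens r : {set brauer r.+2} := e_cup r |: [set of_perm s | s : 'S_r.+2].

Lemma of_perm_gens r s : of_perm s \in gens r.
Proof. by rewrite !inE imset_f ?orbT. Qed.

(** By the decomposition, what must be generated is lift_cup y, which is e_cup
    times y with two vertical lines added in front.  Adding them maps
    permutations to permutations and e_cup to a conjugate of e_cup, so induction
    on r applies. *)
Lemma brauer_gen r (x : brauer r.+2) : x \in sgen (gens r).
Proof.
have [k] := ubnP r; elim: k r x => // k IHk r x ltrk.
have pbG (s : 'S_r.+2) : of_perm s \in sgen (gens r).
  by apply: mem_sgen; apply: of_perm_gens.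
have eG : e_cup r \in sgen (gens r) by apply: mem_sgen; rewrite !inE eqxx.
have addG y : oplus (of_perm 1 : brauer 2) (y : brauer r) \in sgen (gens r).
  case: r {x} ltrk y pbG eG => [|[|r]] ltrk y pbG eG.
  - by have [s ->] := small_brauer y isT; rewrite oplus_of_perm pbG.
  - by have [s ->] := small_brauer y isT; rewrite oplus_of_perm pbG.
  have addgen b : b \in gens r -> oplus (of_perm 1 : brauer 2) b \in sgen (gens r.+2).
    rewrite in_setU1 => /orP[/eqP->|/imsetP[s _ ->]]; last first.
      by rewrite oplus_of_perm; exact: pbG.
    pose a' : 'I_r.+4 := rshift 2 (cup0 r); pose b' : 'I_r.+4 := rshift 2 (cup1 r).
    have [s [s0 s1]] := perm_two_points (cup01 r.+2) (isT : a' != b').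
    have A := is_arc_conj s (e_cup_arc r.+2); rewrite s0 s1 in A.
    suff -> : oplus (of_perm 1 : brauer 2) (e_cup r) =
        of_perm s^-1 * e_cup r.+2 * of_perm s.
      by apply: sgen_closed (pbG _); apply: sgen_closed eG.
    apply: is_arc_inj A; have [e0 e0' ei] := e_cup_arc r; split.
    - by have := mate_oplusr (of_perm 1 : brauer 2) (e_cup r) (inl (cup0 r)); rewrite e0.
    - by have := mate_oplusr (of_perm 1 : brauer 2) (e_cup r) (inr (cup0 r)); rewrite e0'.
    move=> i n0 n1; have := splitK (m := 2) (n := r.+2) i.
    case: (split _) => l /= iE; subst i.
      have := mate_oplusl (of_perm 1 : brauer 2) (e_cup r) (inl l).
      by rewrite mate_of_perm /= perm1.
    have := mate_oplusr (of_perm 1 : brauer 2) (e_cup r) (inl l).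
    by rewrite ei.
  have : y \in sgen (gens r) by apply: IHk; lia.
  elim/sgen_ind => [b|{}y b _ yG bG]; first exact: addgen.
  rewrite -(of_perm1_mul (of_perm 1 : brauer 2)) oplusM.
  exact: sgen_closed (addgen _ bG).
have liftG y : lift_cup y \in sgen (gens r).
  rewrite /lift_cup -(mul_of_perm1 cup) -{1}(of_perm1_mul y) oplusM.
  exact: sgen_closed.
case: (brauer_decomposition x) => [[s ->]|[s [y [t ->]]]]; first exact: pbG.
by rewrite !sgen_closed.
Qed.

Definition idem_gen r : {set brauer r} := sgen [set x | x * x == x].

(** The block of the upper point b runs through the arcs of both copies of
    e_cup and ends at the lower point b. *)
Lemma e_cup_tperm_e_cup r (b : 'I_r) :
  e_cup r * of_perm (tperm (cup1 r) (rshift 2 b)) * e_cup r = e_cup r.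
Proof.
set s := tperm _ _; have [e0 e0' ei] := e_cup_arc r.
have b0 : rshift 2 b != cup0 r :> 'I_r.+2 by [].
have b1 : rshift 2 b != cup1 r :> 'I_r.+2 by [].
have sE (i : 'I_r.+2) : s^-1 i = s i by rewrite /s tpermV.
have s0 : s (cup0 r) = cup0 r by rewrite tpermD.
have s1 : s (cup1 r) = rshift 2 b by rewrite tpermL.
have sb : s (rshift 2 b) = cup1 r by rewrite tpermR.
have seP := mate_of_perm_mul s (e_cup r).
rewrite -mulgA; apply: is_arc_inj (e_cup_arc r); split; first exact: mate_mul_inl.
  by apply: mate_mul_inr; apply: mate_mul_inr.
move=> i n0 n1; have xi := ei _ n0 n1; have [ib|ib] := eqVneq i (rshift 2 b); last first.
  apply: (mate_mul_through xi).
  have si : s i = i by rewrite tpermD // eq_sym.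
  by have := seP (inl i); rewrite xi /= sE si perm1.
subst i; apply: mate_mul => //; set x := e_cup r; set y := of_perm s * e_cup r.
have := glue_upper x y (inl (rshift 2 b)); rewrite xi => /connect_trans; apply.
have := glue_lower x y (inl (rshift 2 b)).
have -> : mate y (inl (rshift 2 b)) = inl (cup0 r).
  have := seP (inl (cup1 r)); rewrite -{2}[inl (cup1 r)]e0 mateK /=.
  by rewrite !sE s1 s0.
move=> /connect_trans; apply.
have := glue_upper x y (inr (cup0 r)); rewrite e0' => /connect_trans; apply.
have := glue_lower x y (inl (cup1 r)).
by have := seP (inl (rshift 2 b)); rewrite xi /= sE sb perm1 => ->.
Qed.

(** Write e for e_cup, (1 a) for the transposition of a with the second end of
    the arc of e, and c_a for the conjugate of e by (1 a).  As e (1 a) e = e and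
    (1 b)(1 a) = (a b)(1 b), the product of the four idempotents e, c_b, c_a, e
    is e (1 b)(1 a) e = (a b) e (1 b) e = (a b) e. *)
Lemma lift_tperm_idem_gen r (a b : 'I_r) :
  lift_cup (of_perm (tperm a b)) \in idem_gen r.+2.
Proof.
have idG x : x * x = x -> x \in idem_gen r.+2.
  by move=> xx; apply: mem_sgen; rewrite inE xx.
have [->|ab] := eqVneq a b; first by rewrite tperm1 idG // e_cup_idem.
pose a' : 'I_r.+2 := rshift 2 a; pose b' : 'I_r.+2 := rshift 2 b.
have rI (i j : 'I_r) : i != j -> (rshift 2 i : 'I_r.+2) != rshift 2 j.
  by apply: contraNneq => /(@rshift_inj 2 r) ->.
have ab' : a' != b' := rI _ _ ab.
pose e := e_cup r; pose pa := of_perm (tperm (cup1 r) a').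
pose pc := of_perm (tperm (cup1 r) b').
pose pt := of_perm (tperm a' b').
have tE : perm_oplus (1 : 'S_2) (tperm a b) = tperm a' b'.
  apply/permP => i; rewrite -(splitK (m := 2) (n := r) i); case: (split _) => l /=.
    by rewrite perm_oplusl perm1 tpermD //; case: l => -[|[|]].
  rewrite perm_oplusr; have [->|al] := eqVneq l a; first by rewrite !tpermL.
  have [->|bl] := eqVneq l b; first by rewrite !tpermR.
  by rewrite !tpermD // 1?eq_sym // 1?eq_sym rI // eq_sym.
have ptE : pt = oplus (of_perm 1 : brauer 2) (of_perm (tperm a b)).
  by rewrite oplus_of_perm tE.
have et : e * pt = lift_cup (of_perm (tperm a b)).
  rewrite ptE; apply: (etrans (esym (@oplusM 2 r cup (of_perm 1) (of_perm 1) _))).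
  by rewrite mul_of_perm1 of_perm1_mul.
have te : pt * e = lift_cup (of_perm (tperm a b)).
  rewrite ptE; apply: (etrans (esym (@oplusM 2 r (of_perm 1) cup _ (of_perm 1)))).
  by rewrite mul_of_perm1 of_perm1_mul.
have cE c : tperm (cup1 r) c = (tperm (cup1 r) c)^-1 by rewrite tpermV.
have cid c :
    of_perm (tperm (cup1 r) c) * e * of_perm (tperm (cup1 r) c) \in idem_gen r.+2.
  apply: idG; rewrite {1 3 5}cE; exact: is_arc_idem (is_arc_conj _ (e_cup_arc r)).
have eG : e \in idem_gen r.+2 by apply: idG; apply: e_cup_idem.
suff <- : e * (pc * e * pc) * (pa * e * pa) * e = lift_cup (of_perm (tperm a b)).
  apply: (sgen_closed _ eG); apply: (sgen_closed _ (cid _)).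
  exact: sgen_closed eG (cid _).
have ea : e * pa * e = e := e_cup_tperm_e_cup a.
have eb : e * pc * e = e := e_cup_tperm_e_cup b.
have pp : pc * pa = pt * pc.
  rewrite -!of_permM; congr of_perm; rewrite conjgCV tpermV tpermJ; congr (_ * _).
  by rewrite tpermL tpermD // 1?eq_sym // tpermC.
have -> : e * (pc * e * pc) * (pa * e * pa) * e = (e * pc * e) * (pc * pa) * (e * pa * e).
  by rewrite !mulgA.
by rewrite ea eb pp mulgA et -te -!mulgA [e * _]mulgA eb te.
Qed.

(** As lift_cup is multiplicative, the generators suffice: transpositions and the
    idempotent e_cup. *)
Lemma lift_idem_gen r (y : brauer r) : lift_cup y \in idem_gen r.+2.
Proof.
have pbI (s : 'S_r) : lift_cup (of_perm s) \in idem_gen r.+2.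
  have [ts -> _] := prod_tpermP s; elim: ts => [|[a b] ts IHts].
    by rewrite big_nil; apply: mem_sgen; rewrite inE e_cup_idem.
  by rewrite big_cons of_permM lift_cupM sgen_closed // lift_tperm_idem_gen.
case: r y pbI => [|[|r]] y pbI.
- by have [s ->] := small_brauer y isT.
- by have [s ->] := small_brauer y isT.
have eI : lift_cup (e_cup r) \in idem_gen r.+4.
  by apply: mem_sgen; rewrite inE -lift_cupM e_cup_idem.
elim/sgen_ind: (brauer_gen y) => [a|x b _ xI].
  by rewrite in_setU1 => /orP[/eqP->|/imsetP[s _ ->]].
by rewrite in_setU1 => /orP[/eqP->|/imsetP[s _ ->]]; rewrite lift_cupM sgen_closed.
Qed.

(** * The lower bound *)

Section WreathCoord.
Variables S T : finSemigroupType.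
Implicit Types (v w : wreath S T) (x : option T).

Definition wfun w x : S := (wreath_val w).1 x.
Definition wbot w : T := (wreath_val w).2.

Lemma wfunM v w x : wfun (v * w) x = wfun v x * wfun w (act1 x (wbot v)).
Proof. by case: v w => [[f t]] [[g u]]; rewrite /wfun /= ffunE. Qed.

Lemma wbotM v w : wbot (v * w) = wbot v * wbot w.
Proof. by case: v w => [[f t]] [[g u]]. Qed.

Lemma wreath_eq v w : wfun v =1 wfun w -> wbot v = wbot w -> v = w.
Proof.
case: v w => [[f t]] [[g u]]; rewrite /wfun /wbot /= => fg ->.
by congr (Wreath (_, _)); apply/ffunP.
Qed.

End WreathCoord.

Lemma act1A (T : finSemigroupType) (x : option T) t u :
  act1 (act1 x t) u = act1 x (t * u).
Proof. by case: x => [s|]; rewrite /act1 ?mulgA. Qed.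

Section AperiodicStep.
Variables (T S A : finSemigroupType) (I : Type) (D : {set T}).
Variables (alpha : T -> S) (h : I -> T -> A) (r : nat) (phi : brauer r.+2 -> S).
Hypotheses (cD : mulg_closed D) (alphaM : {in D &, {morph alpha : x y / x * y}}).
Hypotheses (hM : forall i, {in D &, {morph h i : x y / x * y}}) (apA : aperiodic A).
Hypotheses (phiM : {morph phi : x y / x * y}).
Hypothesis onto : forall b, exists2 t, t \in D & alpha t = phi b.

(** The maps h i are the actions of D on the coordinates of an aperiodic layer
    over a fixed state of the layers below, where they are multiplicative.  Take
    z to be the identity of a group V in D that lifts the permutations: h i
    sends V to a trivial group, so V cannot move a state that was just
    multiplied by z.  An idempotent eps over e_cup with eps z = eps then leads
    to a state fixed by V and by eps, and these two generate D'. *)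
Lemma aperiodic_step : exists (z eps : T) (D' : {set T}),
  [/\ z \in D, eps \in D, D' \subset D, mulg_closed D'
    & forall b, exists2 t, t \in D' & alpha t = phi b] /\
  [/\ alpha z = phi (of_perm 1), alpha eps = phi (e_cup r),
      forall s, exists t, [/\ t \in D', alpha t = phi (of_perm s)
        & forall i, h i z * h i t = h i z]
    & forall i t, t \in D' -> h i eps * h i t = h i eps].
Proof.
pose U := [set t in D | [exists s, alpha t == phi (of_perm s)]].
have UP t : reflect (t \in D /\ exists s, alpha t = phi (of_perm s)) (t \in U).
  rewrite inE; apply: (iffP andP) => -[tD].
    by case/existsP=> s /eqP; split=> //; exists s.
  by case=> s ts; split=> //; apply/existsP; exists s; apply/eqP.
have cU : mulg_closed U.
  move=> t u /UP[tD [s ts]] /UP[uD [s' us]]; apply/UP; split; first exact: cD.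
  by exists (s * s'); rewrite alphaM // ts us of_permM phiM.
have [t1 t1D t1E] := onto (of_perm 1).
have t1U : t1 \in U by apply/UP; split=> //; exists 1.
have [z [zU zz zinv]] := closed_has_local_group cU t1U.
have [zD [s0 zs0]] := UP _ zU.
(* z is idempotent and alpha z is a unit, so alpha z is the identity. *)
have z1 : alpha z = phi (of_perm 1).
  have : alpha z * phi (of_perm s0^-1) = alpha z * alpha z * phi (of_perm s0^-1).
    by rewrite -alphaM // zz.
  by rewrite zs0 -mulgA -phiM -of_permM mulgV -phiM mul_of_perm1 => ->.
pose V := [set t in U | (z * t == t) && (t * z == t)].
have VP t : reflect [/\ t \in U, z * t = t & t * z = t] (t \in V).
  have -> : (t \in V) = [&& t \in U, z * t == t & t * z == t] by rewrite [LHS]inE.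
  by apply: (iffP and3P) => -[tU /eqP zt /eqP tz].
have VD t : t \in V -> t \in D by case/VP=> /UP[].
have cV : mulg_closed V.
  move=> t u /VP[tU zt tz] /VP[uU zu uz]; apply/VP; split; first exact: cU.
    by rewrite mulgA zt.
  by rewrite -mulgA uz.
have zV : z \in V by apply/VP.
have hV i t : t \in V -> h i t = h i z.
  move=> tV; have sub : is_subgroup (h i @: V).
    split=> [_ _ /imsetP[u uV ->] /imsetP[v vV ->]|].
      by rewrite -hM ?VD // imset_f // cV.
    exists (h i z); first exact: imset_f.
    move=> _ /imsetP[u uV ->]; have [uU zu uz] := VP _ uV.
    rewrite -!hM ?VD // zu uz; split=> //.
    have [k [kU zk kz uk]] := zinv u uU zu uz.
    have [k' [k'U zk' k'z kk']] := zinv k kU zk kz.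
    have kV : k \in V by apply/VP.
    exists (h i k); first exact: imset_f.
    rewrite -!hM ?VD // uk; split=> //; congr (h i _).
    by rewrite -[u]uz -kk' [u * (k * k')]mulgA uk zk'.
  have /eqP/cards1P[a E] := apA sub.
  have : h i t \in [set a] by rewrite -E imset_f.
  have : h i z \in [set a] by rewrite -E imset_f.
  by rewrite !inE => /eqP-> /eqP.
have liftV s : exists2 t, t \in V & alpha t = phi (of_perm s).
  have [t tD ts] := onto (of_perm s); have tU : t \in U by apply/UP; split=> //; exists s.
  exists (z * t * z).
    by apply/VP; rewrite !mulgA zz -!mulgA zz; split=> //; rewrite mulgA !cU.
  by rewrite !alphaM ?cD // z1 ts -!phiM of_perm1_mul mul_of_perm1.
pose C := [set t in D | [&& alpha t == phi (e_cup r), z * t == t & t * z == t]].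
have CP t : reflect [/\ t \in D, alpha t = phi (e_cup r), z * t = t & t * z = t]
    (t \in C).
  by rewrite inE; apply: (iffP and4P) => -[tD /eqP ta /eqP zt /eqP tz].
have cC : mulg_closed C.
  move=> t u /CP[tD ta zt tz] /CP[uD ua zu uz]; apply/CP; split; first exact: cD.
  - by rewrite alphaM // ta ua -phiM e_cup_idem.
  - by rewrite mulgA zt.
  by rewrite -mulgA uz.
have [c cinD ce] := onto (e_cup r).
have cinC : z * c * z \in C.
  apply/CP; rewrite !mulgA zz -!mulgA zz; split=> //; first by rewrite mulgA !cD.
  by rewrite !alphaM ?cD // z1 ce -!phiM mul_of_perm1 of_perm1_mul.
have [eps /CP[epsD epsE zeps epsz] epseps] := closed_has_idem cC cinC.
have D'D : sgen (V :|: [set eps]) \subset D.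
  apply: sgen_sub => //; apply/subsetP => t; rewrite !inE => /orP[|/eqP-> //].
  by case/andP=> /andP[].
have genD t : t \in sgen (V :|: [set eps]) -> t \in D := subsetP D'D t.
exists z, eps, (sgen (V :|: [set eps])); split; split=> //.
- exact: sgen_closed.
- move=> b; elim/sgen_ind: (brauer_gen b) => [a|x a _ [t tD' tx]];
    rewrite in_setU1 => /orP[/eqP->|/imsetP[s _ ->]].
  + by exists eps => //; apply: mem_sgen; rewrite in_setU set11 orbT.
  + have [t tV ts] := liftV s; exists t => //.
    by apply: mem_sgen; rewrite in_setU tV.
  + exists (t * eps); last by rewrite (alphaM (genD _ tD') epsD) tx epsE phiM.
    by apply: sgen_mulr => //; rewrite in_setU set11 orbT.
  + have [u uV us] := liftV s; exists (t * u).
      by apply: sgen_mulr => //; rewrite in_setU uV.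
    by rewrite (alphaM (genD _ tD') (VD _ uV)) tx us phiM.
- move=> s; have [t tV ts] := liftV s; exists t; split=> //.
    by apply: mem_sgen; rewrite in_setU tV.
  by move=> i; rewrite (hV i t tV) -hM // zz.
move=> i t; elim/sgen_ind => [a|x a xD' xfix].
  rewrite in_setU in_set1 => /orP[aV|/eqP->]; last by rewrite -hM // epseps.
  by rewrite (hV i a aV) -hM // epsz.
rewrite in_setU in_set1 => /orP[aV|/eqP->].
  by rewrite (hM i (genD _ xD') (VD _ aV)) mulgA xfix (hV i a aV) -hM // epsz.
by rewrite (hM i (genD _ xD') epsD) mulgA xfix -hM // epseps.
Qed.

End AperiodicStep.

(** The invariant of the lower bound.  T is only a common source for S and for
    the layers of X, so that the induction can pass to the lower layers by
    composing beta with projections.  For the state of t0 a lift of each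
    permutation is produced which fixes it, because one may still multiply the
    state by a group identity; multiplying by eps as well gives a state that
    all of D' fixes, but then the rank of alpha has dropped by two, to that of
    the identity of the next corner. *)
Lemma kr_product_fixed k X : kr_product k X ->
  forall (T S : finSemigroupType) (D : {set T}) (alpha : T -> S) (beta : T -> X),
  mulg_closed D -> {in D &, {morph alpha : x y / x * y}} ->
  {in D &, {morph beta : x y / x * y}} ->
  forall m p, m = (k + p.+1)%N ->
  forall phi : brauer m.*2 -> S, {morph phi : x y / x * y} -> injective phi ->
  (forall b, exists2 t, t \in D & alpha t = phi b) ->
  exists (phi' : brauer p.*2.+2 -> S) (t0 eps : T) (D' : {set T}),
  [/\ {morph phi' : x y / x * y}, injective phi', D' \subset D, mulg_closed D'
    & forall b, exists2 t, t \in D' & alpha t = phi' b] /\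
  [/\ t0 \in D /\ alpha t0 = phi' (of_perm 1),
      eps \in D /\ alpha eps = phi' (e_cup _),
      forall s, exists t, [/\ t \in D', alpha t = phi' (of_perm s)
        & beta (t0 * t) = beta t0]
    & forall t, t \in D' -> beta (t0 * eps * t) = beta (t0 * eps)].
Proof.
move=> krX T S; elim: krX => {k X} [A apA|k A G X0 apA _ IH] D alpha beta cD alphaM betaM.
  move=> m p -> phi phiM phi_inj onto.
  have [z [eps [D' [[zD epsD sD' cD' onto'] [z1 eps1 fixz fixeps]]]]] :=
    aperiodic_step (r := p.*2) (I := unit) (h := fun=> beta) cD alphaM (fun=> betaM)
      apA phiM onto.
  have fix_in t : t \in D' -> t \in D := subsetP sD' t.
  exists phi, z, eps, D'; split; split=> //.
    move=> s; have [t [tD' ts tfix]] := fixz s; exists t; split=> //.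
    by rewrite (betaM _ _ zD (fix_in _ tD')) (tfix tt).
  move=> t tD'; rewrite (betaM _ _ (cD _ _ zD epsD) (fix_in _ tD')) (betaM _ _ zD epsD).
  by rewrite -mulgA (fixeps tt).
move=> m p mE phi phiM phi_inj onto.
have cDD u v : u \in D -> v \in D -> u * v \in D by apply: cD.
pose y t := wbot (beta t); pose beta0 t := wbot (y t).
have yM : {in D &, {morph y : u v / u * v}}.
  by move=> u v uD vD; rewrite /y betaM // wbotM.
have beta0M : {in D &, {morph beta0 : u v / u * v}}.
  by move=> u v uD vD; rewrite /beta0 yM // wbotM.
have mE' : m = (k + p.+2)%N by rewrite mE addSnnS.
have [phi1 [t1 [eps1 [D1 [[phi1M phi1_inj sD1 cD1 onto1]]]]]] :=
  IH D alpha beta0 cD alphaM beta0M m p.+1 mE' phi phiM phi_inj onto.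
case=> [[t1D t1E] [eps1D eps1E] _ fix1].
have D1D t : t \in D1 -> t \in D := subsetP sD1 t.
pose w := t1 * eps1; have wD : w \in D by apply: cD.
pose phi' (b : brauer p.*2.+2) := phi1 (lift_cup b).
have phi'M : {morph phi' : u v / u * v} by move=> u v; rewrite /phi' lift_cupM phi1M.
have wE : alpha w = phi' (of_perm 1) by rewrite alphaM // t1E eps1E -phi1M of_perm1_mul.
have fix1' t : t \in D1 -> beta0 w * beta0 t = beta0 w.
  by move=> tD1; rewrite -beta0M; auto.
(* Over the fixed state of w, the group coordinates of t act by a homomorphism,
   so they send the idempotent t to 1. *)
have fix_idem t : t \in D1 -> t * t = t -> y w * y t = y w.
  move=> tD1 tt; apply: wreath_eq => [q|]; last by rewrite wbotM; apply: fix1'.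
  rewrite wfunM; set q' := act1 q _.
  have q'E : act1 q' (wbot (y t)) = q' by rewrite /q' act1A -/(beta0 t) fix1'.
  have := congr1 (fun v => wfun v q') (yM _ _ (D1D _ tD1) (D1D _ tD1)).
  rewrite tt wfunM q'E => /esym hh.
  have h1 : wfun (y t) q' = (1 : G) by apply: (mulgI (wfun (y t) q' : G)); rewrite mulg1.
  by rewrite h1; apply: (@mulg1 G).
pose D2 := sgen [set t in D1 | t * t == t].
have sD2 t : t \in D2 -> t \in D1.
  by apply/subsetP: t; apply: sgen_sub => //; apply/subsetP => t; rewrite inE => /andP[].
have D2D t : t \in D2 -> t \in D by move/sD2/D1D.
have fix2 t : t \in D2 -> y w * y t = y w.
  elim/sgen_ind => [a|x a xD2 xfix]; rewrite inE => /andP[aD1 /eqP aa].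
    exact: fix_idem.
  by rewrite yM; auto; rewrite mulgA xfix fix_idem.
have alpha2M : {in D2 &, {morph alpha : u v / u * v}}.
  by move=> u v uD vD; rewrite alphaM ?D2D.
pose h q t := wfun (beta t) (act1 q (y w)).
have hM q : {in D2 &, {morph h q : u v / u * v}}.
  move=> u v uD2 vD2; rewrite /h betaM; auto; rewrite wfunM act1A.
  by congr (_ * wfun _ (act1 _ _)); apply: fix2.
have onto2 b : exists2 t, t \in D2 & alpha t = phi' b.
  have idem_onto a : a * a = a ->
      exists2 t, t \in [set t in D1 | t * t == t] & alpha t = phi1 a.
    move=> aa; have [t tD1 ta] := onto1 a.
    pose C := [set t in D1 | alpha t == phi1 a].
    have cC : mulg_closed C.
      move=> u v; rewrite !inE => /andP[uD /eqP ua] /andP[vD /eqP va].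
      by rewrite cD1 //= alphaM; auto; rewrite ua va -phi1M aa.
    have tC : t \in C by rewrite inE tD1 ta eqxx.
    have [e] := closed_has_idem cC tC; rewrite inE => /andP[eD1 /eqP ea] ee.
    by exists e => //; rewrite inE eD1 ee eqxx.
  rewrite /phi'; elim/sgen_ind: (lift_idem_gen b) => [a|x a _ [t tD2 tx]];
    rewrite inE => /eqP /idem_onto[e eD1 ea].
    by exists e => //; apply: mem_sgen.
  exists (t * e); first exact: sgen_mulr.
  by rewrite alphaM; [rewrite tx ea phi1M | exact: D2D | apply/D2D/mem_sgen].
have [z [eps [D' [[zD2 epsD2 sD' cD' onto'] [z1 epsE fixz fixeps]]]]] :=
  aperiodic_step (@sgen_closed _ _) alpha2M hM apA phi'M onto2.
have D'2 t : t \in D' -> t \in D2 := subsetP sD' t.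
have [zD epsD] := (D2D _ zD2, D2D _ epsD2).
have yz : y (w * z) = y w by rewrite yM; auto.
have yze : y (w * z * eps) = y w by rewrite yM ?yz; auto.
have fix_state u t : u \in D -> y u = y w -> t \in D' ->
    (forall q, wfun (beta u) q * h q t = wfun (beta u) q) -> beta (u * t) = beta u.
  move=> uD yu /D'2 tD2 fixt; rewrite betaM; auto.
  by apply: wreath_eq => [q|]; rewrite ?wfunM ?wbotM -?/(y _) yu; auto.
have wfunw q u : u \in D -> wfun (beta (w * u)) q = wfun (beta w) q * h q u.
  by move=> uD; rewrite betaM // wfunM.
exists phi', (w * z), eps, D'; split; split=> //.
- by move=> u v /phi1_inj/lift_cup_inj.
- by apply/subsetP => t /D'2/D2D.
- by split; auto; rewrite alphaM // wE z1 -phi'M of_perm1_mul.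
- move=> s; have [t [tD' ts tfix]] := fixz s; exists t; split=> //.
  apply: fix_state; auto => q.
  by rewrite wfunw // -mulgA; congr (_ * _); apply: tfix.
move=> t tD'; apply: fix_state; auto => q.
rewrite -mulgA wfunw ?hM //; auto; rewrite -mulgA; congr (_ * _).
by rewrite -mulgA (fixeps q).
Qed.

Lemma complexity_lower_bound n k : kr_le (brauer n.*2) k -> n <= k.
Proof.
case=> X krX [D [f [cD fM fD]]]; rewrite leqNgt; apply/negP => ltkn.
(* What is left has rank 2 (n - k), at least 2, and contains a transposition. *)
have nE : n = (k + (n - k.+1).+1)%N by lia.
have onto (b : brauer n.*2) : exists2 t, t \in D & f t = b.
  have : b \in f @: D by rewrite fD inE.
  by case/imsetP=> t tD ->; exists t.
have [phi [t0 [eps [D' [[phiM phi_inj sD' _ _] [[t0D t0E] _ fixt _]]]]]] :=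
  kr_product_fixed krX (beta := id) cD fM (fun _ _ _ _ => erefl) nE (phi := id)
    (fun _ _ => erefl) (@inj_id _) onto.
have [t [tD' tE t0t]] := fixt (tperm (cup0 _) (cup1 _)).
have := fM _ _ t0D (subsetP sD' _ tD').
rewrite t0t t0E tE -phiM of_perm1_mul => /phi_inj/of_perm_inj/permP/(_ (cup0 _)).
by rewrite perm1 tpermL.
Qed.

(** * The upper bound *)

Lemma band_aperiodic (A : finSemigroupType) : (forall x : A, x * x = x) -> aperiodic A.
Proof.
move=> idA B [cB [e eB Be]]; apply/eqP/cards1P; exists e; apply/setP => x.
rewrite inE; apply/idP/eqP => [xB|->//].
by have [_ xe [y _ [xy _]]] := Be x xB; rewrite -xe -{1}xy mulgA idA.
Qed.

Section Resets.
Variable Y : finType.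

(** The constant maps of Y and the identity map, written None. *)
Definition resets := option Y.
HB.instance Definition _ := Finite.on resets.

Definition resets_mul (a b : resets) : resets := if b is Some _ then b else a.

Lemma resets_mulA : associative resets_mul.
Proof. by move=> a b [c|]. Qed.

HB.instance Definition _ := isSemigroup.Build resets resets_mulA.

Lemma resets_aperiodic : aperiodic resets.
Proof. by apply: band_aperiodic => -[]. Qed.

End Resets.

Section Ideal.
Variables (S : finSemigroupType) (e : S).

Definition in_ideal : pred S := fun x => [exists y, exists z, x == y * e * z].

Lemma in_idealP x : reflect (exists y z, x = y * e * z) (in_ideal x).
Proof.
apply: (iffP existsP) => [[y /existsP[z /eqP ->]]|[y [z ->]]]; first by exists y, z.
by exists y; apply/existsP; exists z.
Qed.

Lemma in_ideal_mul : mulg_closed in_ideal.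
Proof.
move=> _ _ /in_idealP[y [z ->]] /in_idealP[y' [z' ->]]; apply/in_idealP.
by exists y, (z * (y' * e * z')); rewrite !mulgA.
Qed.

Record ideal := Ideal { ideal_val : S; _ : in_ideal ideal_val }.

HB.instance Definition _ := [isSub for ideal_val].
HB.instance Definition _ := [Finite of ideal by <:].
HB.instance Definition _ :=
  SubChoice_isSubSemigroup.Build _ in_ideal ideal in_ideal_mul.

(** The maps from S to S that are right multiplications by elements of the ideal
    S e S, the constant maps and the identity map, written None. *)
Definition ideal_resets := option (ideal + S).
HB.instance Definition _ := Finite.on ideal_resets.

Definition ideal_resets_mul (a b : ideal_resets) : ideal_resets :=
  match b with
  | None => a
  | Some (inr c) => b
  | Some (inl t) =>
      match a with
      | None => b
      | Some (inr c) => Some (inr (c * ideal_val t))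
      | Some (inl u) => Some (inl (u * t))
      end
  end.

Lemma ideal_resets_mulA : associative ideal_resets_mul.
Proof. by move=> [[a|a]|] [[b|b]|] [[c|c]|] //=; rewrite ?mulgA. Qed.

HB.instance Definition _ := isSemigroup.Build ideal_resets ideal_resets_mulA.

(** When e S e is trivial the ideal S e S is a rectangular band. *)
Lemma ideal_resets_aperiodic : (forall x, e * x * e = e) -> aperiodic ideal_resets.
Proof.
move=> He; apply: band_aperiodic => -[[[x xI]|c]|] //.
congr (Some (inl _)); apply: val_inj => /=; have /in_idealP[y [z ->]] := xI.
have -> : y * e * z * (y * e * z) = y * (e * (z * y) * e) * z by rewrite !mulgA.
by rewrite He.
Qed.

End Ideal.

Section Machine.
Variable S : finSemigroupType.

(** The letters of S, sent to a product with m group layers, drive the automaton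
    delta: its state is a function of the element reached, the adjoined identity
    standing for the initial state.  Only lam s for single letters s is given,
    and lam need not be multiplicative. *)
Definition realizes m (Q : Type) (q0 : Q) (delta : Q -> S -> Q) : Prop :=
  exists (X : finSemigroupType) (lam : S -> X) (rho : option X -> Q),
  [/\ kr_product m X, rho None = q0
    & forall z s, rho (act1 z (lam s)) = delta (rho z) s].

Definition bottom (A X : finSemigroupType) (w : option (wreath A X)) : option X :=
  omap (@wbot A X) w.

Lemma bottom_act1 (A X : finSemigroupType) (w : option (wreath A X)) v :
  bottom (act1 w v) = act1 (bottom w) (wbot v).
Proof. by case: w => [w|] //=; rewrite wbotM. Qed.

(** One more group layer and one more aperiodic layer over delta.  The state of
    the latter is None until the first letter is read, as A may lack an
    identity. *)
Definition cascade (Q : Type) (delta : Q -> S -> Q) (G : finGroupType)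
    (A : finSemigroupType) (gamma : Q -> S -> G) (al : Q -> G -> S -> A)
    (c : Q * G * option A) (s : S) : Q * G * option A :=
  let: (q, g, a) := c in (delta q s, g * gamma q s, act1 a (al q g s)).

Lemma realizes_cascade m (Q : Type) q0 (delta : Q -> S -> Q) (G : finGroupType)
    (A : finSemigroupType) (gamma : Q -> S -> G) (al : Q -> G -> S -> A) :
  aperiodic A -> realizes m q0 delta ->
  realizes m.+1 (q0, 1 : G, None : option A)
    (cascade delta gamma al).
Proof.
move=> apA [X [lam [rho [krX rho0 rhoM]]]]; pose GG := semigroup_of_group G.
pose grp (w : option (wreath GG X)) : G := if w is Some v then wfun v None else 1.
pose lam1 s : wreath GG X := Wreath ([ffun z => gamma (rho z) s : GG], lam s).
pose lam2 s : wreath A (wreath GG X) :=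
  Wreath ([ffun w => al (rho (bottom w)) (grp w) s], lam1 s).
pose top (w : option (wreath A (wreath GG X))) : option A :=
  omap (fun v => wfun v None) w.
have grpM w s : grp (act1 w (lam1 s)) = grp w * gamma (rho (bottom w)) s.
  case: w => [v|] /=; last by rewrite /wfun /= ffunE mul1g.
  by rewrite wfunM /wfun /= ffunE.
exists (wreath A (wreath GG X)), lam2.
exists (fun w => (rho (bottom (bottom w)), grp (bottom w), top w)); split.
- exact: KRStep.
- by rewrite /= rho0.
move=> w s; rewrite !bottom_act1 rhoM grpM; congr (_, _, _).
case: w => [v|] /=; last by rewrite /wfun /= ffunE.
by rewrite wfunM /wfun /= ffunE.
Qed.

(** An automaton that computes the product of its letters gives a division: its
    output is determined by the element reached, and multiplicative on the
    subsemigroup generated by the letters. *)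
Lemma realizes_kr_le m (Q : Type) (q0 : Q) delta (out : Q -> S) (one : S) :
  left_id one mulg -> realizes m q0 delta -> out q0 = one ->
  (forall q s, out (delta q s) = out q * s) -> kr_le S m.
Proof.
move=> one1 [X [lam [rho [krX rho0 rhoM]]]] out0 outM.
exists X => //; pose D := sgen [set lam s | s : S].
pose f z := out (rho (Some z)).
have f1 s : f (lam s) = s.
  by rewrite /f -[Some _]/(act1 None (lam s)) rhoM outM rho0 out0 one1.
have fM z : z \in D -> forall y, out (rho (act1 y z)) = out (rho y) * f z.
  elim/sgen_ind => [_ /imsetP[s _ ->] y|{}z _ _ IHz /imsetP[s _ ->] y].
    by rewrite rhoM outM f1.
  rewrite -act1A rhoM outM IHz -mulgA; congr (_ * _).
  by rewrite /f -[Some (z * _)]/(act1 (Some z) (lam s)) rhoM outM.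
exists D, f; split; first exact: sgen_closed.
  by move=> y z _ zD; rewrite /f -(fM _ zD (Some y)).
apply/setP => s; rewrite inE -(f1 s) imset_f //.
by apply: mem_sgen; apply: imset_f.
Qed.

(** What a state tells about the product p of the letters read: its exact value
    when the second component is true, else that it lies in a left ideal. *)
Definition tile (t : S * bool) (p : S) : Prop :=
  if t.2 then p = t.1 else exists y, p = y * t.1.

Variable one : S.
Hypotheses (mul1 : left_id one mulg) (mul1r : right_id one mulg).

(** Some automaton with m group layers locates the product in left ideals
    S u with e u = u, unless it knows the product exactly. *)
Definition tracks m (e : S) : Prop :=
  exists (Q : Type) (q0 : Q) (delta : Q -> S -> Q) (psi : Q -> S * bool),
  [/\ realizes m q0 delta, psi q0 = (one, true),
      forall q, ~~ (psi q).2 -> e * (psi q).1 = (psi q).1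
    & forall q s p, tile (psi q) p -> tile (psi (delta q s)) (p * s)].

(** No letter read: the product is the identity, exactly.  Otherwise it lies
    in S. *)
Lemma tracks0 : tracks 0 one.
Proof.
pose X : finSemigroupType := resets void.
exists (option X), None, (fun _ _ => Some (None : X)).
exists (fun q => (one, ~~ isSome q)); split=> //.
  exists X, (fun=> None), id; split=> //; last by move=> [[[]|]|].
  by apply: KRBase; apply: resets_aperiodic.
by move=> q s p _; exists (p * s); rewrite mul1r.
Qed.

(* Here e is the identity of the corner of the current rank, with group kappa G;
   the other elements of the corner lie in the ideal of e', the idempotent of the
   next rank. *)
Section Refine.
Variables (G : finGroupType) (kappa : G -> S) (e e' : S).
Hypotheses (kappaM : {morph kappa : g h / g * h}) (kappa1 : kappa 1 = e).
Hypothesis cover : forall x, 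
  (exists g, e * x * e = kappa g) \/ (exists y v, e * x * e = y * e' * v).

Section State.
Variables (Q : Type) (delta : Q -> S -> Q) (psi : Q -> S * bool).
Hypothesis psi_e : forall q, ~~ (psi q).2 -> e * (psi q).1 = (psi q).1.
Hypothesis psi_tile : forall q s p, tile (psi q) p -> tile (psi (delta q s)) (p * s).

(* Between left ideals S u and S u', with u = (psi q).1 and u' that of the next
   state, u s = kappa g u' says that s acts by a permutation. *)
Definition group_move q s := [pick g | (psi q).1 * s == kappa g * (psi (delta q s)).1].

Definition gamma q s : G :=
  if (psi q).2 then 1 else odflt 1 (group_move q s).

Lemma kappaK g x : ~~ (psi x).2 -> kappa g^-1 * (kappa g * (psi x).1) = (psi x).1.
Proof. by move=> cx; rewrite mulgA -kappaM mulVg kappa1 psi_e. Qed.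

(** The four ways in which a letter acts.  In MoveReset an exact value
    turns into a left ideal: being known, it can be stored again as a value
    relative to this ideal.  In MoveDrop the rank drops, and the image of the
    whole left ideal lies in that of e' v u'. *)
Variant move_spec q s : Prop :=
| MoveExact of (psi (delta q s)).2
| MoveReset y of ~~ (psi (delta q s)).2 & (psi q).2 & gamma q s = 1
    & (psi q).1 * s = y * (psi (delta q s)).1
| MoveGroup of ~~ (psi (delta q s)).2 & ~~ (psi q).2 & group_move q s
    & (psi q).1 * s = kappa (gamma q s) * (psi (delta q s)).1
| MoveDrop y v of ~~ (psi (delta q s)).2 & ~~ (psi q).2 & group_move q s = None
    & gamma q s = 1 & (psi q).1 * s = y * e' * v * (psi (delta q s)).1.

Lemma moveP q s : move_spec q s.
Proof.
have [ex'|co'] := boolP (psi (delta q s)).2; first exact: MoveExact.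
have [ex|co] := boolP (psi q).2.
  have : tile (psi q) (psi q).1 by rewrite /tile ex.
  move/(psi_tile s); rewrite {1}/tile (negPf co') => -[y yE].
  by apply: (MoveReset co' ex _ yE); rewrite /gamma ex.
have : tile (psi q) (psi q).1 by rewrite /tile (negPf co); exists one; rewrite mul1.
move/(psi_tile s); rewrite {1}/tile (negPf co') => -[y yE].
have exe : (psi q).1 * s = e * y * e * (psi (delta q s)).1.
  by rewrite -[in LHS](psi_e co) -mulgA yE -!mulgA (psi_e co').
case Et: (group_move q s) => [g|].
  apply: MoveGroup => //; first by rewrite Et.
  rewrite /gamma (negPf co) Et /=; move: Et; rewrite /group_move.
  by case: pickP => // h /eqP hE [<-].
case: (cover y) => [[g gE]|[y' [v vE]]].
  by move: Et; rewrite /group_move; case: pickP => // /(_ g); rewrite exe gE eqxx.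
apply: (@MoveDrop q s y' v) => //; first by rewrite /gamma (negPf co) Et.
by rewrite exe vE.
Qed.

End State.

(** The refined state is a cell relative to u: the stored letter a stands for the
    left ideal of e' v, or for the exact value v, and the group coordinate g turns
    it into that of v kappa(g) u.  A reset at group coordinate g stores v
    kappa(g)^-1 in order to cancel g, and leaves g unchanged. *)
Lemma tracks_refine m : tracks m e -> e' * e' = e' -> tracks m.+1 e'.
Proof.
move=> [Q [q0 [delta [psi [rz psi0 psi_e psi_tile]]]]] e'e'.
pose A : finSemigroupType := resets (S * bool)%type.
pose al q (g : G) s : A :=
  let u := (psi q).1 in let u' := (psi (delta q s)).1 in
  if (psi (delta q s)).2 then None else
  if (psi q).2 then
    omap (fun y => (y * kappa g^-1, true)) [pick y | u * s == y * u']
  else if group_move delta psi q s then None else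
    omap (fun v => (v * kappa g^-1, false))
      [pick v | [exists y, u * s == y * e' * v * u']].
pose cell (a : option A) : S * bool :=
  if a is Some (Some (v, b)) then (if b then v else e' * v, b) else (one, true).
have cell_none a : cell (act1 a (None : A)) = cell a by case: a => [[[v b]|]|].
have cell_some a v b : cell (act1 a (Some (v, b) : A)) = (if b then v else e' * v, b).
  by case: a.
have cell_e a : ~~ (cell a).2 -> e' * (cell a).1 = (cell a).1.
  by case: a => [[[v []]|]|] //= _; rewrite mulgA e'e'.
clearbody cell.
pose psi' (c : Q * G * option A) : S * bool :=
  let: (q, g, a) := c in
  if (psi q).2 then psi q else ((cell a).1 * kappa g * (psi q).1, (cell a).2).
have sub_tile q g a p : tile (psi' (q, g, a)) p -> tile (psi q) p.
  rewrite /psi'; case: ifPn => // co; rewrite {2}/tile (negPf co) /tile /=.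
  case: ifP => _ => [->|[y ->]]; first by exists ((cell a).1 * kappa g).
  by exists (y * ((cell a).1 * kappa g)); rewrite !mulgA.
exists (Q * G * option A)%type, (q0, 1, None).
exists (cascade delta (gamma delta psi) al), psi'; split.
- exact: realizes_cascade (@resets_aperiodic _) rz.
- by rewrite /= psi0.
- case=> -[q g] a /=; case: ifPn => [->//|_] /= ca.
  by rewrite !mulgA cell_e.
case=> -[q g] a s p tp; have tq := sub_tile _ _ _ _ tp.
have -> : psi' (cascade delta (gamma delta psi) al (q, g, a) s) =
    if (psi (delta q s)).2 then psi (delta q s) else
    ((cell (act1 a (al q g s))).1 * kappa (g * gamma delta psi q s) * (psi (delta q s)).1,
     (cell (act1 a (al q g s))).2) by [].
have := psi_tile _ s _ tq.
case: (moveP psi_e psi_tile q s)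
    => [->//|y co' ex g1 yE|co' co tr gE|y v co' co tr g1 vE] tq'; rewrite (negPf co').
- rewrite /al (negPf co') ex.
  case: pickP => [y' /eqP y'E|/(_ y)]; last by rewrite yE eqxx.
  rewrite -[omap _ _]/(Some (y' * kappa g^-1, true)) cell_some g1 mulg1 /tile /=.
  rewrite -!mulgA (kappaK psi_e) // -y'E.
  by move: tq; rewrite /tile ex => ->.
- rewrite /al (negPf co') (negPf co) tr cell_none.
  move: tp; rewrite /psi' (negPf co) /tile /= kappaM.
  case: ifP => _; first by move=> ->; rewrite -!mulgA gE.
  by case=> z ->; exists z; rewrite -!mulgA gE.
rewrite /al (negPf co') (negPf co) tr [isSome _]/=.
case: pickP => [v' /existsP[y' /eqP v'E]|/(_ v)]; last first.
  by move/existsP; case; exists y; rewrite vE.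
rewrite -[omap _ _]/(Some (v' * kappa g^-1, false)) cell_some g1 mulg1 /tile /=.
move: tq; rewrite /tile (negPf co) => -[z ->].
by exists (z * y'); rewrite -!mulgA (kappaK psi_e) // v'E !mulgA.
Qed.

(** At the last rank the stored letter is a value y with product y kappa(g) u.
    A drop q of rank now multiplies y by kappa(g) q kappa(g)^-1, an element
    of the band S e' S, so the product is known exactly at all times. *)
Lemma tracks_last m : tracks m e -> (forall x, e' * x * e' = e') -> kr_le S m.+1.
Proof.
move=> [Q [q0 [delta [psi [rz psi0 psi_e psi_tile]]]]] He'.
pose A : finSemigroupType := ideal_resets e'.
pose al q (g : G) s : A :=
  let u := (psi q).1 in let u' := (psi (delta q s)).1 in
  if (psi (delta q s)).2 then None else
  if (psi q).2 then
    omap (fun y => inr (y * kappa g^-1)) [pick y | u * s == y * u']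
  else if group_move delta psi q s then None else
    omap inl [pick t : ideal e' | kappa g * (u * s) == ideal_val t * (kappa g * u')].
pose ev (a : option A) : S :=
  match a with
  | Some (Some (inl t)) => ideal_val t
  | Some (Some (inr c)) => c
  | _ => one
  end.
have ev_none a : ev (act1 a (None : A)) = ev a by case: a => [[[t|c]|]|].
have ev_inl a t : ev (act1 a (Some (inl t) : A)) = ev a * ideal_val t.
  by case: a => [[[u|c]|]|] //=; rewrite mul1.
have ev_inr a c : ev (act1 a (Some (inr c) : A)) = c by case: a => [[[u|?]|]|].
have ev_init : ev None = one by [].
clearbody ev.
pose out (c : Q * G * option A) : S :=
  let: (q, g, a) := c in
  if (psi q).2 then (psi q).1 else ev a * kappa g * (psi q).1.
have rz' := realizes_cascade (gamma delta psi) al (ideal_resets_aperiodic He') rz.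
apply: (realizes_kr_le (out := out) mul1 rz'); first by rewrite /= psi0.
case=> -[q g] a s.
have tq : tile (psi q) (out (q, g, a)).
  by rewrite /tile /out; case: (psi q).2 => //; exists (ev a * kappa g).
have -> : out (cascade delta (gamma delta psi) al (q, g, a) s) =
    if (psi (delta q s)).2 then (psi (delta q s)).1 else
    ev (act1 a (al q g s)) * kappa (g * gamma delta psi q s) * (psi (delta q s)).1 by [].
have := psi_tile _ s _ tq.
case: (moveP psi_e psi_tile q s) => [ex'|y co' ex g1 yE|co' co tr gE|y v co' co tr g1 vE].
- by rewrite /tile ex' => <-.
- rewrite (negPf co') /al (negPf co') ex => _.
  case: pickP => [y' /eqP y'E|/(_ y)]; last by rewrite yE eqxx.
  rewrite -[omap _ _]/(Some (inr (y' * kappa g^-1))) ev_inr g1 mulg1 -!mulgA.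
  by rewrite (kappaK psi_e) // -y'E /out ex.
- rewrite (negPf co') /al (negPf co') (negPf co) tr ev_none => _.
  by rewrite /out (negPf co) kappaM -!mulgA gE.
rewrite (negPf co') /al (negPf co') (negPf co) tr [isSome _]/= => _.
case: pickP => [t /eqP tE|].
  rewrite -[omap _ _]/(Some (inl t)) ev_inl g1 mulg1 /out (negPf co).
  by rewrite -!mulgA tE.
have tI : in_ideal e' (kappa g * y * e' * (v * kappa g^-1)).
  by apply/in_idealP; exists (kappa g * y), (v * kappa g^-1).
move/(_ (Ideal tI)) => /=.
by rewrite vE -!mulgA (kappaK psi_e) // eqxx.
Qed.

End Refine.

Section Corner.
Variables (r : nat) (phi : brauer r.+2 -> S).
Hypothesis phiM : {morph phi : x y / x * y}.
Hypothesis corner : forall x, exists b, phi (of_perm 1) * x * phi (of_perm 1) = phi b.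

(** A non-permutation of the corner factors through e_cup, the identity of the
    next corner. *)
Lemma corner_cover x :
  (exists s, phi (of_perm 1) * x * phi (of_perm 1) = phi (of_perm s)) \/
  (exists y v, phi (of_perm 1) * x * phi (of_perm 1) = y * phi (e_cup r) * v).
Proof.
have [b ->] := corner x; case: (brauer_decomposition b) => [[s ->]|[s [y [t ->]]]].
  by left; exists s.
right; exists (phi (of_perm s * lift_cup y)), (phi (of_perm t)).
by rewrite -!phiM -[_ * _ * e_cup _]mulgA -lift_cupM mul_of_perm1.
Qed.

Lemma corner_lift x : exists y, phi (e_cup r) * x * phi (e_cup r) = phi (lift_cup y).
Proof.
have [b bE] := corner x; have [y yE] := e_cup_sandwich b; exists y.
have e1 : phi (e_cup r) * phi (of_perm 1) = phi (e_cup r) by rewrite -phiM mul_of_perm1.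
have e1' : phi (of_perm 1) * phi (e_cup r) = phi (e_cup r) by rewrite -phiM of_perm1_mul.
by rewrite -yE !phiM -bE !mulgA e1 -[RHS]mulgA e1'.
Qed.

End Corner.

(** The corner of phi is a copy of the monoid of degree 2n + 3 inside S; each layer
    replaces it by the corner of phi composed with lift_cup, two degrees lower,
    and the last layer, of degree 3, stands over the trivial corner of degree 1. *)
Lemma tracks_brauer n m (phi : brauer n.+1.*2.+1 -> S) :
  {morph phi : x y / x * y} -> tracks m (phi (of_perm 1)) ->
  (forall x, exists b, phi (of_perm 1) * x * phi (of_perm 1) = phi b) ->
  kr_le S (m + n.+1).
Proof.
elim: n m phi => [|n IHn] m phi phiM tr corner.
all: have kappaM' : {morph (fun s => phi (of_perm s)) : s t / s * t}
       by move=> s t; rewrite of_permM phiM.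
  rewrite addn1; apply: (tracks_last kappaM' erefl (corner_cover phiM corner) tr) => x.
  have [y ->] := corner_lift phiM corner x; have [s ->] := small_brauer y isT.
  by congr (phi (lift_cup (of_perm _))); apply/permP => i; rewrite !ord1.
rewrite -addSnnS; apply: (IHn m.+1 (fun b => phi (lift_cup b))).
- by move=> x y; rewrite lift_cupM phiM.
- apply: (tracks_refine kappaM' erefl (corner_cover phiM corner) tr).
  by rewrite -phiM e_cup_idem.
exact: corner_lift phiM corner.
Qed.

End Machine.

Lemma complexity_upper_bound n : kr_le (brauer n.+1.*2.+1) n.+1.
Proof.
have one_l N : left_id (of_perm 1 : brauer N) mulg by move=> x; apply: of_perm1_mul.
have one_r N : right_id (of_perm 1 : brauer N) mulg by move=> x; apply: mul_of_perm1.
apply: (@tracks_brauer (brauer n.+1.*2.+1) _ (one_l _) n 0 id).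
- by [].
- exact: tracks0 (one_l _) (one_r _).
by move=> x; exists x; rewrite of_perm1_mul mul_of_perm1.
Qed.

Lemma kr_le_embed (S T : finSemigroupType) (f : S -> T) (s0 : S) k :
  {morph f : x y / x * y} -> injective f -> kr_le T k -> kr_le S k.
Proof.
move=> fM f_inj [X krX [D [g [cD gM gD]]]]; exists X => //.
pose h x := odflt s0 [pick s | f s == g x].
have hE x s : f s = g x -> h x = s.
  move=> fs; rewrite /h; case: pickP => [s' /eqP|/(_ s)]; rewrite -fs ?eqxx //.
  by move/f_inj.
pose D' := [set x in D | [exists s, f s == g x]].
have D'P x : x \in D' -> x \in D /\ f (h x) = g x.
  rewrite inE => /andP[xD /existsP[s /eqP fs]].
  by split=> //; rewrite (hE x s).
have hM : {in D' &, {morph h : x y / x * y}}.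
  move=> x y /D'P[xD fx] /D'P[yD fy]; apply: hE.
  by rewrite fM fx fy gM.
exists D', h; split=> //.
  move=> x y /D'P[xD fx] /D'P[yD fy]; rewrite inE cD //=; apply/existsP.
  by exists (h x * h y); rewrite fM fx fy gM.
apply/setP => s; rewrite inE; apply/imsetP.
have : f s \in g @: D by rewrite gD inE.
case/imsetP=> x xD fs; exists x; last by rewrite (hE x s).
by rewrite inE xD; apply/existsP; exists s; rewrite fs.
Qed.

Theorem theorem3p2 (n : nat) (n_gt0 : 0 < n) :
  complexity_is (brauer (2 * n)) n /\ complexity_is (brauer (2 * n + 1)) n.
Proof.
rewrite addn1 mul2n.
pose emb (x : brauer n.*2) : brauer n.*2.+1 := oplus (of_perm 1 : brauer 1) x.
have embM : {morph emb : x y / x * y}.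
  by move=> x y; rewrite /emb -{1}(of_perm1_mul (of_perm 1 : brauer 1)) oplusM.
have emb_inj : injective emb by apply: (@oplus_injr 1).
have even_odd k : kr_le (brauer n.*2.+1) k -> kr_le (brauer n.*2) k.
  exact: (kr_le_embed (of_perm 1) embM emb_inj).
have upper : kr_le (brauer n.*2.+1) n.
  case: n n_gt0 {emb embM emb_inj even_odd} => // n _.
  exact: complexity_upper_bound.
split; split=> //.
- exact: even_odd.
- exact: complexity_lower_bound.
by move=> k /even_odd; apply: complexity_lower_bound.
Qed.
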